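(* Let $N\subseteq (M,\mathcal{J})$ be a submanifold of a generalized almost complex manifold, with $\mathcal J$ having classical tensors $(A,\pi,\sigma)$, such that for every $x\in N$ the subspace $T_xN\subseteq T_xM$ has the induced structure $\tilde{\mathcal{J}}_x$. If $TN+\mathrm{im}\,\sharp_\pi$ (taken along $N$) is a smooth subbundle of the restriction $T_NM$ of the tangent bundle $TM$ to $N$, then the field of induced structures $x\mapsto\tilde{\mathcal{J}}_x$ is smooth (i.e. is a smooth bundle endomorphism of $TN\oplus T^*N$); and, if moreover $\mathcal{J}$ is integrable, then $\tilde{\mathcal{J}}$ is integrable too.
   Context: Everything is $C^\infty$. For a finite-dimensional real vector space $W$ put $\mathbf{W}=W\oplus W^*$ with the neutral metric $g((X,\alpha),(Y,\mu))=\frac12(\alpha(Y)+\mu(X))$ (extended complex-bilinearly to the complexification $\mathbf{W}^c$). A linear generalized complex structure on $W$ is $\mathcal{J}\in \mathrm{End}(\mathbf{W})$ with $\mathcal{J}^2=-\mathrm{Id}$ and $g(\mathcal{X},\mathcal{J}\mathcal{Y})+g(\mathcal{J}\mathcal{X},\mathcal{Y})=0$. It can be written $\mathcal{J}(X,\alpha)=(AX+\sharp_\pi\alpha,\ \flat_\sigma X-A^*\alpha)$, where $A\in \mathrm{End}(W)$, $\pi\in\wedge^2W$, $\sigma\in\wedge^2W^*$, $\sharp_\pi\alpha=i(\alpha)\pi$, $\flat_\sigma X=i(X)\sigma$, and $A^*$ is the transpose. $\mathcal{J}$ is equivalent to its $i$-eigenspace $L\subset\mathbf{W}^c$, a maximal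 $g$-isotropic subspace with $L\cap\bar L=0$. A generalized almost complex structure on a manifold $M$ is a smooth bundle endomorphism $\mathcal{J}$ of $\mathbf{T}M=TM\oplus T^*M$ that is a linear generalized complex structure at each point; $A,\pi,\sigma$ are then tensor fields. It is integrable if the space of sections of its $i$-eigenbundle $L\subset \mathbf{T}M\otimes\mathbb{C}$ is closed under the Courant bracket $[(X,\alpha),(Y,\mu)]=([X,Y],\,L_X\mu-L_Y\alpha+\frac12 d(\alpha(Y)-\mu(X)))$. For a linear map $f_*:V\to W$ with transpose $f^*:W^*\to V^*$ and a subspace $U$ of $\mathbf{W}$ (or, with complexified maps, of $\mathbf W^c$), the pullback is $\overleftarrow{f}^*U=\{(X,f^*\eta)\,:\,(f_*X,\eta)\in U\}$. A subspace $\iota_*:V\subseteq W$ of $(W,\mathcal{J})$ has the induced structure if $\tilde L=\overleftarrow{\iota}^*L$ is the $i$-eigenspace of a linear generalized complex structure $\tilde{\mathcal{J}}$ on $V$ (equivalently $\overleftarrow{\iota}^*L\cap\overleftarrow{\iota}^*\bar L=0$); $\tilde{\mathcal{J}}$ is called the induced structure. *)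

(* Defs.v *)
From HB Require Import structures.
From mathcomp Require Import all_boot all_order all_algebra.
From mathcomp Require Import all_classical all_reals all_analysis.
From mathcomp Require Import complex.

Set Implicit Arguments.
Unset Strict Implicit.
Unset Printing Implicit Defensive.

Import Order.TTheory GRing.Theory Num.Theory.
Import numFieldNormedType.Exports.

Local Open Scope classical_set_scope.
Local Open Scope ring_scope.
Local Open Scope complex_scope.

(* Conventions.  Vectors and covectors are columns of components with respect
   to a basis and its dual basis; (X, alpha) in W (+) W^* is [col_mx X alpha],
   and endomorphisms act by multiplication on the left.  Accordingly the
   transpose of a linear map is given by the transposed matrix. *)

Section Linear.
Variable R : realType.

Definition neutral_metric (n : nat) (u v : 'cV[R]_(n + n)) : R :=
  2^-1 * (((dsubmx u)^T *m usubmx v) 0 0 + ((dsubmx v)^T *m usubmx u) 0 0).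

Definition linear_gcs (n : nat) (J : 'M[R]_(n + n)) : Prop :=
  J *m J = - 1%:M /\
  forall u v, neutral_metric u (J *m v) + neutral_metric (J *m u) v = 0.

(* J (0, alpha) = (sharp_pi alpha, - A^* alpha). *)
Definition sharp_pi (n : nat) (J : 'M[R]_(n + n)) : 'M[R]_n := ursubmx J.

Definition complexify (m n : nat) (A : 'M[R]_(m, n)) : 'M[R[i]]_(m, n) :=
  map_mx (real_complex R) A.

Definition i_eigenspace (n : nat) (J : 'M[R]_(n + n)) :
    set 'cV[R[i]]_(n + n) :=
  [set u | complexify J *m u = 'i%C *: u].

Definition pullback (K : fieldType) (p n : nat) (F : 'M[K]_(n, p))
    (U : set 'cV[K]_(n + n)) : set 'cV[K]_(p + p) :=
  [set w | exists (X : 'cV[K]_p) (eta : 'cV[K]_n),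
     w = col_mx X (F^T *m eta) /\ U (col_mx (F *m X) eta)].

(* Jt is the structure induced by J on the source of the injective map F. *)
Definition induced_structure (p n : nat) (F : 'M[R]_(n, p))
    (J : 'M[R]_(n + n)) (Jt : 'M[R]_(p + p)) : Prop :=
  linear_gcs Jt /\ i_eigenspace Jt = pullback (complexify F) (i_eigenspace J).

End Linear.

Section Calculus.
Variable R : realType.

Definition partial (n : nat) (j : 'I_n) (f : 'cV[R]_n -> R) (y : 'cV[R]_n) : R
  := 'D_(delta_mx j 0) f y.

Fixpoint C_on (k n : nat) (U : set 'cV[R]_n) (f : 'cV[R]_n -> R) : Prop :=
  (forall y, U y -> {for y, continuous f}) /\
  match k with
  | 0 => True
  | k'.+1 => forall j : 'I_n,
      (forall y, U y -> derivable f y (delta_mx j 0)) /\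
      C_on k' U (partial j f)
  end.

(* Only meaningful for U open. *)
Definition smooth_on (m k n : nat) (U : set 'cV[R]_n)
    (F : 'cV[R]_n -> 'M[R]_(m, k)) : Prop :=
  forall r i j, C_on r U (fun y => F y i j).

Definition jac (m n : nat) (F : 'cV[R]_n -> 'cV[R]_m) (y : 'cV[R]_n) :
    'M[R]_(m, n) :=
  \matrix_(i, j) partial j (fun z => F z i 0) y.

(* Complex-valued functions of real variables are differentiated through their
   real and imaginary parts. *)
Definition ReM (m k : nat) (A : 'M[R[i]]_(m, k)) : 'M[R]_(m, k) :=
  map_mx (@complex.Re R) A.
Definition ImM (m k : nat) (A : 'M[R[i]]_(m, k)) : 'M[R]_(m, k) :=
  map_mx (@complex.Im R) A.

Definition smoothC_on (m k n : nat) (U : set 'cV[R]_n)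
    (F : 'cV[R]_n -> 'M[R[i]]_(m, k)) : Prop :=
  smooth_on U (fun y => ReM (F y)) /\ smooth_on U (fun y => ImM (F y)).

Definition jacC (m n : nat) (F : 'cV[R]_n -> 'cV[R[i]]_m) (y : 'cV[R]_n) :
    'M[R[i]]_(m, n) :=
  complexify (jac (fun z => ReM (F z)) y)
  + 'i%C *: complexify (jac (fun z => ImM (F z)) y).

(* [X, Y]^i = X^j d_j Y^i - Y^j d_j X^i *)
Definition lie_bracket (n : nat) (X Y : 'cV[R]_n -> 'cV[R[i]]_n)
    (y : 'cV[R]_n) : 'cV[R[i]]_n :=
  jacC Y y *m X y - jacC X y *m Y y.

(* (L_X mu)_i = X^j d_j mu_i + mu_j d_i X^j *)
Definition lie_derivative (n : nat) (X mu : 'cV[R]_n -> 'cV[R[i]]_n)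
    (y : 'cV[R]_n) : 'cV[R[i]]_n :=
  jacC mu y *m X y + (jacC X y)^T *m mu y.

(* The differential of a function, seen as taking values in 1 x 1 matrices. *)
Definition differential (n : nat) (h : 'cV[R]_n -> 'cV[R[i]]_1)
    (y : 'cV[R]_n) : 'cV[R[i]]_n :=
  (jacC h y)^T.

Definition courant_bracket (n : nat) (s t : 'cV[R]_n -> 'cV[R[i]]_(n + n))
    (y : 'cV[R]_n) : 'cV[R[i]]_(n + n) :=
  let X z := usubmx (s z) in let alpha z := dsubmx (s z) in
  let Y z := usubmx (t z) in let mu z := dsubmx (t z) in
  col_mx (lie_bracket X Y y)
    (lie_derivative X mu y - lie_derivative Y alpha y
     + 2^-1 *: differential
         (fun z => (alpha z)^T *m Y z - (mu z)^T *m X z) y).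

End Calculus.

(* The inverse [chart_inv a] is a total function; its values outside
   [chart_map a @` chart_dom a] are irrelevant. *)
Record manifold (R : realType) (n : nat) := Manifold {
  space :> topologicalType;
  space_hausdorff : hausdorff_space space;
  space_second_countable : @second_countable space;
  atlas : Type;
  chart_dom : atlas -> set space;
  chart_map : atlas -> space -> 'cV[R]_n;
  chart_inv : atlas -> 'cV[R]_n -> space;
  chart_cover : forall x : space, exists a, chart_dom a x;
  chart_dom_open : forall a, open (chart_dom a);
  chart_img_open : forall a, open (chart_map a @` chart_dom a);
  chart_mapK : forall a x, chart_dom a x -> chart_inv a (chart_map a x) = x;
  chart_map_cont : forall a x, chart_dom a x -> {for x, continuous (chart_map a)};
  chart_inv_cont : forall a y, (chart_map a @` chart_dom a) y ->
    {for y, continuous (chart_inv a)};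
  chart_transition : forall a b,
    smooth_on (chart_map a @` (chart_dom a `&` chart_dom b))
      (fun y => chart_map b (chart_inv a y))
}.

Section Manifolds.
Variables (R : realType) (n : nat) (M : manifold R n).

Definition chart_img (a : atlas M) (U : set M) : set 'cV[R]_n :=
  chart_map a @` (chart_dom a `&` U).

(* Jacobian at x of the change of coordinates from a to b. *)
Definition tjac (a b : atlas M) (x : M) : 'M[R]_n :=
  jac (fun y => chart_map b (chart_inv a y)) (chart_map a x).

(* Change of components in TM (+) T^*M from a to b: covectors transform by the
   transpose of the inverse Jacobian, which is the Jacobian from b to a. *)
Definition big_tjac (a b : atlas M) (x : M) : 'M[R]_(n + n) :=
  block_mx (tjac a b x) 0 0 (tjac b a x)^T.

(* A not necessarily smooth field of endomorphisms of TM (+) T^*M, given by its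
   components in each chart. *)
Record endo_field := EndoField {
  endo_comp :> atlas M -> M -> 'M[R]_(n + n);
  endo_law : forall a b x, chart_dom a x -> chart_dom b x ->
    endo_comp b x *m big_tjac a b x = big_tjac a b x *m endo_comp a x
}.

Definition smooth_endo (E : endo_field) : Prop :=
  forall a, smooth_on (chart_img a setT) (fun y => E a (chart_inv a y)).

Definition gen_almost_complex (J : endo_field) : Prop :=
  smooth_endo J /\ forall a x, chart_dom a x -> linear_gcs (J a x).

(* A not necessarily smooth section of (TM (+) T^*M) (x) C. *)
Record csection := CSection {
  sec_comp :> atlas M -> M -> 'cV[R[i]]_(n + n);
  sec_law : forall a b x, chart_dom a x -> chart_dom b x ->
    sec_comp b x = complexify (big_tjac a b x) *m sec_comp a x
}.

Definition smooth_section (s : csection) : Prop :=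
  forall a, smoothC_on (chart_img a setT) (fun y => s a (chart_inv a y)).

Definition section_of_L (J : endo_field) (s : csection) : Prop :=
  smooth_section s /\
  forall a x, chart_dom a x -> i_eigenspace (J a x) (s a x).

(* Components in the chart a of the Courant bracket of s and t at x. *)
Definition courant (s t : csection) (a : atlas M) (x : M) : 'cV[R[i]]_(n + n) :=
  courant_bracket (fun y => s a (chart_inv a y)) (fun y => t a (chart_inv a y))
    (chart_map a x).

(* The Courant bracket of smooth sections of (TM (+) T^*M) (x) C is always such
   a section, so closedness only has to assert that its values lie in L. *)
Definition courant_integrable (J : endo_field) : Prop :=
  forall s t : csection, section_of_L J s -> section_of_L J t ->
  forall a x, chart_dom a x -> i_eigenspace (J a x) (courant s t a x).

End Manifolds.

Section Submanifolds.
Variables (R : realType) (p n : nat) (N : manifold R p) (M : manifold R n).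

Definition smooth_map (f : N -> M) : Prop :=
  continuous f /\
  forall a b, smooth_on (chart_img a (f @^-1` chart_dom b))
    (fun y => chart_map b (f (chart_inv a y))).

Definition map_jac (f : N -> M) (a : atlas N) (b : atlas M) (x : N) :
    'M[R]_(n, p) :=
  jac (fun y => chart_map b (f (chart_inv a y))) (chart_map a x).

Definition injective_immersion (f : N -> M) : Prop :=
  [/\ injective f, smooth_map f &
      forall a b x, chart_dom a x -> chart_dom b (f x) ->
        injective (fun v : 'cV[R]_p => map_jac f a b x *m v)].

(* For each x in N, T_xN has the structure Jt_x induced from T_{f x}M. *)
Definition induced_field (f : N -> M) (J : endo_field M) (Jt : endo_field N) :
    Prop :=
  forall a b x, chart_dom a x -> chart_dom b (f x) ->
    induced_structure (map_jac f a b x) (J b (f x)) (Jt a x).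

(* A family V of subspaces of the fibres T_{f x}M, V b x being expressed by
   components in the chart b, is a smooth subbundle of f^*TM if near every
   point it is spanned by a smooth pointwise independent frame (the columns
   of S). *)
Definition smooth_subbundle_along (f : N -> M)
    (V : atlas M -> N -> set 'cV[R]_n) : Prop :=
  forall b x, chart_dom b (f x) ->
  exists (U : set N) (k : nat) (S : N -> 'M[R]_(n, k)),
    [/\ open U, U x, U `<=` f @^-1` chart_dom b,
        forall a, smooth_on (chart_img a U) (fun y => S (chart_inv a y)) &
        forall z, U z -> injective (fun c : 'cV[R]_k => S z *m c) /\
          V b z = range (fun c : 'cV[R]_k => S z *m c)].

(* T_xN + im sharp_pi inside T_{f x}M, in the components of the chart b. *)
Definition tangent_plus_sharp (f : N -> M) (J : endo_field M) (b : atlas M)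
    (x : N) : set 'cV[R]_n :=
  [set w | exists (a : atlas N) (v : 'cV[R]_p) (alpha : 'cV[R]_n),
     chart_dom a x /\ w = map_jac f a b x *m v + sharp_pi (J b (f x)) *m alpha].

End Submanifolds.

(* Main.v *)
(* Near a point of N, let S be a frame of V = TN + im pi, write F for the
   differential of the inclusion and J = (A, pi, sigma).  For (X, xi) tangent
   and cotangent to N there is eta with F^* eta = xi and J (F X, eta) = (F Y, zeta),
   and then Jt (X, xi) = (Y, F^* zeta).  Here eta is unique modulo the
   annihilator of V, so it may be sought as S c, and (Y, c) solves a square
   linear system with smooth coefficients.  Its matrix is invertible because
   Lt and its conjugate are transverse, and Cramer's rule gives the smoothness
   of Jt, as well as a smooth lift of each section of Lt to a section of L
   along N.

   For the integrability, let D denote the componentwise derivative in a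
   chart.  For s, t, w with tangent parts X, Y, Z,
     <[s, t], w> = <D_X t, w> - <D_Y s, w> + (<D_Z s, t> - <s, D_Z t>) / 2,
   where <,> is twice the neutral metric.  If s and t are replaced by their
   lifts along N, this changes only by terms in the second derivatives of the
   inclusion, which cancel by Schwarz's theorem.  Since L is isotropic, the
   right-hand side is tensorial on sections of the form (1 - i J) c, hence can
   be computed from global sections of L obtained with bump functions on M, for
   which it vanishes.  As Lt is maximal isotropic, [s, t] lies in Lt. *)

Require Import Defs.
From HB Require Import structures.
From mathcomp Require Import all_boot all_order all_algebra.
From mathcomp Require Import all_classical all_reals all_analysis.
From mathcomp Require Import complex.
From mathcomp Require Import ring lra.

Set Implicit Arguments.
Unset Strict Implicit.
Unset Printing Implicit Defensive.

Import Order.TTheory GRing.Theory Num.Theory.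
Import numFieldNormedType.Exports.

Local Open Scope classical_set_scope.
Local Open Scope ring_scope.

(** * Differential calculus on coordinate spaces *)

Section MatrixTopology.
Variable R : realType.

Lemma continuous_mx (T : topologicalType) (m k : nat) (f : T -> 'M[R]_(m, k))
    (y : T) :
  (forall i j, {for y, continuous (fun z => f z i j)}) ->
  {for y, continuous f}.
Proof.
move=> fc A [P PP PA] /=.
have: \forall z \near y, forall i j, P i j (f z i j).
  apply: filter_forall => i; apply: filter_forall => j.
  by apply: fc; exact: PP.
rewrite /nbhs/=; apply: filterS => z Pz; exact: PA.
Qed.

Lemma mx_norm_leP (m k : nat) (A : 'M[R]_(m, k)) (e : R) : 0 <= e ->
  (forall i j, `|A i j| <= e) -> `|A| <= e.
Proof.
move=> e0 Ae; rewrite /Num.Def.normr/= mx_normrE.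
by apply/bigmax_leP; split => // -[i j] _; exact: Ae.
Qed.

Lemma ler_mx_norm (m k : nat) (A : 'M[R]_(m, k)) i j : `|A i j| <= `|A|.
Proof.
by rewrite [leRHS]/Num.Def.normr/= mx_normrE; exact: (le_bigmax _ _ (i, j)).
Qed.

Lemma cV_sum_delta (n : nat) (v : 'cV[R]_n) :
  v = \sum_i v i 0 *: delta_mx i 0.
Proof.
by rewrite {1}(matrix_sum_delta v); apply: eq_bigr => i _; rewrite big_ord1.
Qed.

End MatrixTopology.

Section Differentiability.
Variable R : realType.

(** The one-variable mean value theorem applied to [f] along a coordinate line. Locating [c] only by
    [|c| <= |h|] lets one statement cover both signs of [h] and [h = 0]. *)
Lemma coord_MVT (n : nat) (f : 'cV[R]_n -> R) (z : 'cV[R]_n) (j : 'I_n) (h : R) :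
  (forall t, `|t| <= `|h| ->
     derivable f (z + t *: delta_mx j 0) (delta_mx j 0)) ->
  exists2 c, `|c| <= `|h| &
    f (z + h *: delta_mx j 0) - f z = partial j f (z + c *: delta_mx j 0) * h.
Proof.
move=> df; pose g t := f (z + t *: delta_mx j 0).
have dg (t : R) : `|t| <= `|h| ->
    is_derive t (1 : R) g (partial j f (z + t *: delta_mx j 0)).
  move=> /df dft.
  have E : (fun x : R => x^-1 *: ((g \o shift t) (x *: 1) - g t)) =
     (fun x : R => x^-1 *: ((f \o shift (z + t *: delta_mx j 0))
         (x *: delta_mx j 0) - f (z + t *: delta_mx j 0))).
    apply/funext => x; rewrite /g /=; do 3 congr (_ _).
    by rewrite scalerDl [_%:A]mulr1 addrCA.
  by split; [rewrite /derivable E|rewrite /derive E].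
have gc (t : R) : `|t| <= `|h| -> {for t, continuous g}.
  by move=> /dg [dgt _]; apply/differentiable_continuous/derivable1_diffP.
have g0 : g 0 = f z by rewrite /g scale0r addr0.
have [h0|h0|h0] := ltgtP h 0.
- have [||c] := @MVT _ g (fun t => partial j f (z + t *: delta_mx j 0)) h 0 h0.
  + move=> t; rewrite in_itv/= => /andP[ht t0]; apply: dg.
    by rewrite (ltr0_norm t0) (ltr0_norm h0) lerN2 ltW.
  + apply/continuous_in_subspaceT => t; rewrite inE/= in_itv/= => /andP[ht t0].
    by apply: gc; rewrite (ler0_norm t0) (ltr0_norm h0) lerN2.
  rewrite in_itv/= => /andP[hc c0] E; exists c.
    by rewrite (ltr0_norm c0) (ltr0_norm h0) lerN2 ltW.
  by rewrite -g0 -[f _]/(g h) -opprB E sub0r mulrN opprK.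
- have [||c] := @MVT _ g (fun t => partial j f (z + t *: delta_mx j 0)) 0 h h0.
  + move=> t; rewrite in_itv/= => /andP[t0 ht]; apply: dg.
    by rewrite (gtr0_norm t0) (gtr0_norm h0) ltW.
  + apply/continuous_in_subspaceT => t; rewrite inE/= in_itv/= => /andP[t0 ht].
    by apply: gc; rewrite (ger0_norm t0) (gtr0_norm h0).
  rewrite in_itv/= => /andP[c0 hc] E; exists c.
    by rewrite (gtr0_norm c0) (gtr0_norm h0) ltW.
  by rewrite -g0 -[f _]/(g h) E subr0.
- by exists 0; rewrite ?normr0// h0 scale0r addr0 subrr mulr0.
Qed.

Lemma differentiable_littleo (V : normedModType R) (f : V -> R) (x : V)
    (df : {linear V -> R}) :
  continuous df ->
  (forall e : R, 0 < e ->
    \forall h \near 0, `|f (h + x) - f x - df h| <= e * `|h|) ->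
  differentiable f x.
Proof.
move=> dfc H.
have E : f \o shift x = cst (f x) + df +o_ 0 id.
  apply/eqaddoP => e e0; apply: filterS (H e e0) => h /=.
  by rewrite !fctE opprD addrA.
by apply/diff_locallyP; rewrite (diff_unique dfc E).
Qed.

(** Going from [y] to [h + y] one coordinate at a time, the mean value theorem turns each increment
    into an entry of [h] times a partial derivative at a nearby point, which continuity compares
    with its value at [y]. *)
Lemma C1_differentiable (n : nat) (U : set 'cV[R]_n) (f : 'cV[R]_n -> R)
    (y : 'cV[R]_n) : open U -> U y ->
  (forall j z, U z -> derivable f z (delta_mx j 0)) ->
  (forall j, {for y, continuous (partial j f)}) ->
  differentiable f y.
Proof.
move=> oU Uy dfU pc.
pose df (h : 'cV[R]_n) := \sum_j h j 0 * partial j f y.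
have dfl : linear df.
  move=> a u v; rewrite /df scaler_sumr -big_split; apply: eq_bigr => j _.
  by rewrite !mxE mulrDl -scalerAl.
pose dfL := HB.pack_for {linear 'cV[R]_n -> R} df
  (GRing.isLinear.Build _ _ _ _ _ dfl).
have dfc : continuous dfL.
  move=> h; rewrite /dfL /= /df /continuous_at.
  have ac : continuous (fun x : R * R => x.1 + x.2) by exact: add_continuous.
  apply: (cvg_big (P := xpredT) ac (nbhs_filter h)) => j _.
  by apply: cvgMr_tmp; exact: coord_continuous.
apply: (differentiable_littleo dfc) => e e0.
(* Each of the [n] coordinate steps may cost this much times [|h|]; dividing by [n + 1] also covers
   [n = 0]. *)
have e'0 : 0 < e / n.+1%:R by rewrite divr_gt0.
have : \forall z \near y, U z /\
   forall j, `|partial j f y - partial j f z| < e / n.+1%:R.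
  have nU : \forall z \near y, U z by exact: open_nbhs_nbhs.
  have nc : \forall z \near y, forall j,
      `|partial j f y - partial j f z| < e / n.+1%:R.
    apply: (@filter_forall _ _ (fun j z => `|partial j f y - partial j f z|
      < e / n.+1%:R) _ (nbhs_filter y)) => j.
    exact: ((cvgrPdist_lt (partial j f) _).1 (pc j) _ e'0).
  by near do split => //.
move=> /nbhs_ballP[d /= d0 Hd].
near=> h.
have hd : `|h| < d.
  near: h; apply: filterS (nbhsx_ballx (0 : 'cV[R]_n) d d0) => h.
  by rewrite -ball_normE /= sub0r normrN.
(* [tr k] keeps the first [k] coordinates of [h], so the points [y + tr k] lead from [y] to
   [y + h]. *)
pose tr k : 'cV[R]_n := \col_i (if (i < k)%N then h i 0 else 0).
have trS (k : 'I_n) : tr k.+1 = tr k + h k 0 *: delta_mx k 0.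
  apply/colP => i; rewrite !mxE eqxx andbT ltnS leq_eqVlt.
  have [->|ik] := eqVneq i k; first by rewrite eqxx ltnn /= mulr1 add0r.
  by rewrite (_ : (i == k :> nat) = false) ?mulr0 ?addr0//; apply: negbTE ik.
have tr0 : tr 0%N = 0 by apply/colP => i; rewrite !mxE.
have trn : tr n = h by apply/colP => i; rewrite !mxE ltn_ord.
have step (k : 'I_n) : exists2 p, `|p - partial k f y| <= e / n.+1%:R &
    f (y + tr k.+1) - f (y + tr k) = h k 0 * p.
  (* The norm is the largest absolute value of an entry, and the entries of the displacement are
     bounded by those of [h]; hence the segment stays in the ball. *)
  have Hz t : `|t| <= `|h k 0| -> ball y d (y + tr k + t *: delta_mx k 0).
    move=> th; rewrite -ball_normE/= -addrA opprD addNKr normrN.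
    apply: le_lt_trans hd; apply: mx_norm_leP => // i j.
    rewrite ord1 !mxE eqxx andbT.
    have [->|ik] := eqVneq i k.
      by rewrite ltnn add0r mulr1 (le_trans th)// ler_mx_norm.
    by rewrite mulr0 addr0; case: ifP => _; rewrite ?normr0// ler_mx_norm.
  have [|c ch E] := @coord_MVT _ f (y + tr k) k (h k 0).
    by move=> t /Hz/Hd[Uz _]; exact: dfU.
  exists (partial k f (y + tr k + c *: delta_mx k 0)).
    by rewrite distrC ltW//; exact: (Hd _ (Hz _ ch)).2.
  by rewrite trS addrA E mulrC.
have -> : f (h + y) - f y = \sum_(k < n) (f (y + tr k.+1) - f (y + tr k)).
  rewrite -(big_mkord xpredT (fun k => f (y + tr k.+1) - f (y + tr k))).
  by rewrite (@telescope_sumr _ 0 n (fun k => f (y + tr k)))// trn tr0 addr0 (addrC y).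
rewrite /dfL /= /df -sumrB.
apply: le_trans (ler_norm_sum _ _ _) _.
apply: (@le_trans _ _ (\sum_(k < n) `|h| * (e / n.+1%:R))).
  apply: ler_sum => k _; have [p pe ->] := step k.
  by rewrite -mulrBr normrM ler_pM// ler_mx_norm.
rewrite sumr_const card_ord -mulrnAr mulrC ler_wpM2r//.
rewrite -[X in X <= _]mulr_natr -mulrA ler_piMr ?ltW// mulrC.
by rewrite ltr_pdivrMr// mul1r ltr_nat.
Unshelve. all: by end_near. Qed.

Lemma differentiable_cV (V : normedModType R) (n : nat) (g : V -> 'cV[R]_n)
    (y : V) :
  (forall k, differentiable (fun z => g z k 0) y) -> differentiable g y.
Proof.
move=> dg.
have -> : g = \sum_k (fun z => g z k 0 *: (delta_mx k 0 : 'cV[R]_n)).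
  apply/funext => z; rewrite fct_sumE [LHS]cV_sum_delta; exact: eq_bigr.
by apply: differentiable_sum => k; apply: differentiableZl.
Qed.

Lemma partial_comp (n p : nat) (f : 'cV[R]_n -> R) (g : 'cV[R]_p -> 'cV[R]_n)
    (y : 'cV[R]_p) (j : 'I_p) :
  differentiable f (g y) -> (forall k, differentiable (fun z => g z k 0) y) ->
  partial j (fun z => f (g z)) y =
    \sum_k partial k f (g y) * partial j (fun z => g z k 0) y.
Proof.
move=> df dg; have dgy := differentiable_cV dg.
have dfg := differentiable_comp dgy df.
rewrite /partial deriveE; last exact: dfg.
have E : 'd g y (delta_mx j 0) = \col_k partial j (fun z => g z k 0) y.
  rewrite -deriveE// derive_mx; last exact: diff_derivable.
  by apply/colP => k; rewrite !mxE.
rewrite [X in X _ = _](diff_comp dgy df) /= E.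
rewrite [X in 'd f _ X]cV_sum_delta linear_sum /=; apply: eq_bigr => k _.
by rewrite linearZ /= mxE -deriveE// mulrC.
Qed.

End Differentiability.

(** * Functions of class C^r and their closure properties *)

Section SmoothFunctions.
Variable R : realType.

Section OneDomain.
Variable n : nat.
Implicit Types (U V : set 'cV[R]_n) (f g : 'cV[R]_n -> R).

Lemma C_on_cont r U f y : C_on r U f -> U y -> {for y, continuous f}.
Proof. by case: r => [|r] [fc _]; exact: fc. Qed.

(** [C_on] is a condition at each point of [U] separately, with limits and derivatives taken in the
    whole space, so it can be checked with a set [V] chosen for each point. *)
Lemma C_on_local r U f :
  (forall y, U y -> exists2 V, V y & C_on r V f) -> C_on r U f.
Proof.
elim: r f => [|r IH] f H.
  by split => // y /H[V Vy Vf]; exact: C_on_cont Vf Vy.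
split=> [y /H[V Vy Vf]|j]; first exact: C_on_cont Vf Vy.
split=> [y /H[V Vy [_ /(_ j)[df _]]]|]; first exact: df.
by apply: IH => y /H[V Vy [_ /(_ j)[_ Vf]]]; exists V.
Qed.

Lemma C_onS r U V f : V `<=` U -> C_on r U f -> C_on r V f.
Proof. by move=> VU Uf; apply: C_on_local => y /VU Uy; exists U. Qed.

Lemma near_eq_continuous (f g : 'cV[R]_n -> R) (y : 'cV[R]_n) :
  (\near y, f y = g y) -> {for y, continuous f} -> {for y, continuous g}.
Proof.
move=> fg fc; rewrite /continuous_at/prop_for -(nbhs_singleton fg).
exact: cvg_trans (near_eq_cvg fg) fc.
Qed.

(** Derivatives at a point see a whole neighbourhood of it; openness of [U] turns equality on [U]
    into equality near each of its points. *)
Lemma C_on_eq r U f g : open U -> (forall y, U y -> f y = g y) ->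
  C_on r U f -> C_on r U g.
Proof.
move=> oU.
have nfg f' g' : (forall y, U y -> f' y = g' y) -> forall y, U y ->
    \near y, f' y = g' y.
  by move=> fg y Uy; apply: filterS fg _; exact: open_nbhs_nbhs.
elim: r f g => [|r IH] f g fg [fc fd].
  by split=> // y Uy; exact: near_eq_continuous (nfg _ _ fg y Uy) (fc y Uy).
split=> [y Uy|j]; first exact: near_eq_continuous (nfg _ _ fg y Uy) (fc y Uy).
have [dfj Cfj] := fd j; split.
  by move=> y Uy; exact: near_eq_derivable (nfg _ _ fg y Uy) (dfj y Uy).
by apply: IH Cfj => y Uy; exact: near_eq_derive (nfg _ _ fg y Uy).
Qed.

Lemma C_onW r U f : C_on r.+1 U f -> C_on r U f.
Proof.
elim: r f => [|r IH] f [fc fd]; first by split.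
by split=> // j; have [df Cf] := fd j; split=> //; exact: IH.
Qed.

Lemma C_on_cst r U (c : R) : C_on r U (fun=> c).
Proof.
elim: r c => [|r IH] c; split=> //.
- by move=> y _; exact: cst_continuous.
- by move=> y _; exact: cst_continuous.
move=> j; split=> [y _|]; first exact: derivable_cst.
by rewrite (_ : partial j _ = fun=> 0)//; apply/funext => y; exact: derive_cst.
Qed.

Lemma C_on_differentiable r U f y : open U -> C_on r.+1 U f -> U y ->
  differentiable f y.
Proof.
move=> oU [_ fd] Uy; apply: (C1_differentiable oU Uy) => [j|j].
  by have [df _] := fd j.
by have [_ Cf] := fd j; exact: C_on_cont Cf Uy.
Qed.

Lemma C_onD r U f g : open U -> C_on r U f -> C_on r U g ->
  C_on r U (fun y => f y + g y).
Proof.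
move=> oU; elim: r f g => [|r IH] f g [fc fd] [gc gd].
  by split=> // y Uy; exact: continuousD (fc y Uy) (gc y Uy).
split=> [y Uy|j]; first by exact: continuousD (fc y Uy) (gc y Uy).
have [df Cf] := fd j; have [dg Cg] := gd j.
split=> [y Uy|]; first by apply: derivableD; [exact: df|exact: dg].
apply: C_on_eq (IH _ _ Cf Cg) => // y Uy.
by rewrite /partial -deriveD//; [exact: df|exact: dg].
Qed.

(** Induction on the order. In the Leibniz rule each product has an undifferentiated factor, which
    is used one order lower by [C_onW]. *)
Lemma C_onM r U f g : open U -> C_on r U f -> C_on r U g ->
  C_on r U (fun y => f y * g y).
Proof.
move=> oU; elim: r f g => [|r IH] f g Cf Cg.
  case: Cf => fc _; case: Cg => gc _.
  by split=> // y Uy; exact: continuousM (fc y Uy) (gc y Uy).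
have Cf' := C_onW Cf; have Cg' := C_onW Cg.
case: Cf => fc fd; case: Cg => gc gd.
split=> [y Uy|j]; first by exact: continuousM (fc y Uy) (gc y Uy).
have [df dCf] := fd j; have [dg dCg] := gd j.
split=> [y Uy|]; first by apply: derivableM; [exact: df|exact: dg].
apply: C_on_eq (C_onD oU (IH _ _ Cf' dCg) (IH _ _ Cg' dCf)) => // y Uy.
rewrite /partial -[LHS]/(f y *: 'D_(delta_mx j 0) g y + g y *: 'D_(delta_mx j 0) f y).
by rewrite -deriveM//; [exact: df|exact: dg].
Qed.

Lemma C_onV r U f : open U -> (forall y, U y -> f y != 0) -> C_on r U f ->
  C_on r U (fun y => (f y)^-1).
Proof.
move=> oU f0; elim: r => [|r IH] Cf.
  by case: Cf => fc _; split=> // y Uy; exact: continuousV (f0 y Uy) (fc y Uy).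
have Cf' := C_onW Cf.
case: Cf => fc fd; split=> [y Uy|j].
  by exact: continuousV (f0 y Uy) (fc y Uy).
have [df dCf] := fd j.
split=> [y Uy|]; first by apply: derivableV; [exact: f0|exact: df].
have CV := IH Cf'.
apply: C_on_eq (C_onM oU (C_on_cst _ _ (-1)) (C_onM oU (C_onM oU CV CV) dCf)) => //.
move=> y Uy; rewrite /partial deriveV; [|exact: f0|exact: df].
by rewrite mulN1r -mulNr -invfM -expr2.
Qed.

Lemma C_on_sum r U (I : Type) (s : seq I) (P : pred I) (f : I -> 'cV[R]_n -> R) :
  open U -> (forall i, P i -> C_on r U (f i)) ->
  C_on r U (fun y => \sum_(i <- s | P i) f i y).
Proof.
move=> oU Cf; elim: s => [|i s IH].
  by under eq_fun do rewrite big_nil; exact: C_on_cst.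
under eq_fun do rewrite big_cons.
by have [Pi|//] := boolP (P i); apply: C_onD => //; exact: Cf.
Qed.

Lemma C_on_prod r U (I : Type) (s : seq I) (P : pred I) (f : I -> 'cV[R]_n -> R) :
  open U -> (forall i, P i -> C_on r U (f i)) ->
  C_on r U (fun y => \prod_(i <- s | P i) f i y).
Proof.
move=> oU Cf; elim: s => [|i s IH].
  by under eq_fun do rewrite big_nil; exact: C_on_cst.
under eq_fun do rewrite big_cons.
by have [Pi|//] := boolP (P i); apply: C_onM => //; exact: Cf.
Qed.

Lemma partial_coord (i j : 'I_n) y :
  partial j (fun z : 'cV[R]_n => z i 0) y = (i == j)%:R.
Proof.
rewrite /partial.
have /derive_mx : derivable (id : 'cV[R]_n -> 'cV[R]_n) y (delta_mx j 0).
  exact: derivable_id.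
by rewrite derive_id => /matrixP/(_ i 0); rewrite !mxE eqxx andbT => <-.
Qed.

Lemma C_on_coord r U (i : 'I_n) : C_on r U (fun y => y i 0).
Proof.
case: r => [|r]; split=> //; try by move=> y _; exact: coord_continuous.
move=> j; split=> [y _|].
  by apply: diff_derivable; exact: differentiable_coord.
rewrite (_ : partial j _ = fun=> (i == j)%:R); first exact: C_on_cst.
by apply/funext => y; exact: partial_coord.
Qed.

End OneDomain.

(** Induction on the order for all [f] at once: in the chain rule the factor [partial k f] composed
    with [g] is again a composite, of lower order. *)
Lemma C_on_comp (p n r : nat) (U : set 'cV[R]_n) (V : set 'cV[R]_p)
    (f : 'cV[R]_n -> R) (g : 'cV[R]_p -> 'cV[R]_n) :
  open U -> open V -> (forall y, V y -> U (g y)) ->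
  C_on r U f -> (forall k, C_on r V (fun y => g y k 0)) ->
  C_on r V (fun y => f (g y)).
Proof.
move=> oU oV gVU.
have cont (r' : nat) (h : 'cV[R]_n -> R) : C_on r' U h ->
    (forall k, C_on r' V (fun y => g y k 0)) ->
    forall y, V y -> {for y, continuous (fun y => h (g y))}.
  move=> Ch Cg y Vy; apply: continuous_comp; last exact: C_on_cont Ch (gVU _ Vy).
  by apply: continuous_mx => i j; rewrite ord1; exact: C_on_cont (Cg i) Vy.
elim: r f => [|r IH] f Cf Cg; first by split=> //; exact: cont Cf Cg.
split=> [|j]; first exact: cont Cf Cg.
have dg y k : V y -> differentiable (fun z => g z k 0) y.
  by move=> Vy; exact: C_on_differentiable (Cg k) Vy.
have df y : V y -> differentiable f (g y).
  by move=> Vy; exact: C_on_differentiable Cf (gVU _ Vy).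
split=> [y Vy|].
  apply: diff_derivable; apply: differentiable_comp; last exact: df.
  by apply: differentiable_cV => k; exact: dg.
have Cg' k : C_on r V (fun y => g y k 0) by exact: C_onW.
apply: (@C_on_eq _ _ _ (fun y =>
  \sum_k partial k f (g y) * partial j (fun z => g z k 0) y)) => //.
  by move=> y Vy; rewrite partial_comp//; [exact: df|move=> k; exact: dg].
apply: C_on_sum => // k _; apply: C_onM => //; last first.
  by have [_ /(_ j)[]] := Cg k.
by apply: IH => //; have [_ /(_ k)[]] := Cf.
Qed.

End SmoothFunctions.

(** * Smooth matrix-valued functions *)

Section SmoothMatrices.
Variables (R : realType) (q : nat) (U : set 'cV[R]_q).
Hypothesis oU : open U.

Lemma smooth_on_cst m k (A : 'M[R]_(m, k)) : smooth_on U (fun=> A).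
Proof. by move=> r i j; exact: C_on_cst. Qed.

Lemma smooth_on_eq m k (A B : 'cV[R]_q -> 'M[R]_(m, k)) :
  (forall y, U y -> A y = B y) -> smooth_on U A -> smooth_on U B.
Proof. by move=> AB sA r i j; apply: C_on_eq (sA r i j) => // y /AB ->. Qed.

Lemma smooth_onD m k (A B : 'cV[R]_q -> 'M[R]_(m, k)) :
  smooth_on U A -> smooth_on U B -> smooth_on U (fun y => A y + B y).
Proof.
by move=> sA sB r i j; under eq_fun do rewrite mxE; exact: C_onD.
Qed.

Lemma smooth_onZ m k (a : 'cV[R]_q -> R) (B : 'cV[R]_q -> 'M[R]_(m, k)) :
  (forall r, C_on r U a) -> smooth_on U B -> smooth_on U (fun y => a y *: B y).
Proof.
by move=> sA sB r i j; under eq_fun do rewrite mxE; exact: C_onM.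
Qed.

Lemma smooth_onN m k (A : 'cV[R]_q -> 'M[R]_(m, k)) :
  smooth_on U A -> smooth_on U (fun y => - A y).
Proof.
move=> sA; under eq_fun do rewrite -scaleN1r.
by apply: smooth_onZ => // r; exact: C_on_cst.
Qed.

Lemma smooth_onB m k (A B : 'cV[R]_q -> 'M[R]_(m, k)) :
  smooth_on U A -> smooth_on U B -> smooth_on U (fun y => A y - B y).
Proof. by move=> sA sB; apply: smooth_onD => //; exact: smooth_onN. Qed.

Lemma smooth_onM m k l (A : 'cV[R]_q -> 'M[R]_(m, k)) (B : 'cV[R]_q -> 'M[R]_(k, l)) :
  smooth_on U A -> smooth_on U B -> smooth_on U (fun y => A y *m B y).
Proof.
move=> sA sB r i j; under eq_fun do rewrite mxE.
by apply: C_on_sum => // s _; exact: C_onM.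
Qed.

Lemma smooth_on_mxsub m k m' k' f g (A : 'cV[R]_q -> 'M[R]_(m, k)) :
  smooth_on U A -> smooth_on U (fun y => mxsub f g (A y) : 'M[R]_(m', k')).
Proof. by move=> sA r i j; under eq_fun do rewrite mxE; exact: sA. Qed.

Lemma smooth_on_tr m k (A : 'cV[R]_q -> 'M[R]_(m, k)) :
  smooth_on U A -> smooth_on U (fun y => (A y)^T).
Proof. by move=> sA r i j; under eq_fun do rewrite mxE; exact: sA. Qed.

Lemma smooth_on_row_mx m k l (A : 'cV[R]_q -> 'M[R]_(m, k)) (B : 'cV[R]_q -> 'M[R]_(m, l)) :
  smooth_on U A -> smooth_on U B -> smooth_on U (fun y => row_mx (A y) (B y)).
Proof.
move=> sA sB r i j; under eq_fun do rewrite mxE.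
by case: (fintype.split j) => s; [exact: sA|exact: sB].
Qed.

Lemma smooth_on_col_mx m k l (A : 'cV[R]_q -> 'M[R]_(m, k)) (B : 'cV[R]_q -> 'M[R]_(l, k)) :
  smooth_on U A -> smooth_on U B -> smooth_on U (fun y => col_mx (A y) (B y)).
Proof.
move=> sA sB r i j; under eq_fun do rewrite mxE.
by case: (fintype.split i) => s; [exact: sA|exact: sB].
Qed.

Lemma smooth_on_block_mx m k l s (A : 'cV[R]_q -> 'M[R]_(m, k))
    (B : 'cV[R]_q -> 'M[R]_(m, l)) (C : 'cV[R]_q -> 'M[R]_(s, k))
    (D : 'cV[R]_q -> 'M[R]_(s, l)) :
  smooth_on U A -> smooth_on U B -> smooth_on U C -> smooth_on U D ->
  smooth_on U (fun y => block_mx (A y) (B y) (C y) (D y)).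
Proof.
by move=> sA sB sC sD; apply: smooth_on_col_mx; exact: smooth_on_row_mx.
Qed.

Lemma C_on_det r m (A : 'cV[R]_q -> 'M[R]_m) :
  smooth_on U A -> C_on r U (fun y => \det (A y)).
Proof.
move=> sA; apply: C_on_sum => // s _; apply: C_onM => //; first exact: C_on_cst.
by apply: C_on_prod => // i _; exact: sA.
Qed.

Lemma smooth_on_invmx m (A : 'cV[R]_q -> 'M[R]_m) :
  (forall y, U y -> A y \in unitmx) -> smooth_on U A ->
  smooth_on U (fun y => invmx (A y)).
Proof.
move=> Au sA.
(* Cramer's rule: the entries of the adjugate and the determinant are polynomials in the entries of
   [A]. *)
apply: (@smooth_on_eq _ _ (fun y => (\det (A y))^-1 *: \adj (A y))).
  by move=> y /Au Ay; rewrite /invmx Ay.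
apply: smooth_onZ => r => [|i j].
  apply: C_onV => // [y /Au|]; first by rewrite unitmxE unitfE.
  exact: C_on_det.
under eq_fun do rewrite mxE.
apply: C_onM => //; first exact: C_on_cst.
by apply: C_on_det; do 2 apply: smooth_on_mxsub.
Qed.

Lemma smooth_on_comp n m k (V : set 'cV[R]_n) (A : 'cV[R]_n -> 'M[R]_(m, k))
    (g : 'cV[R]_q -> 'cV[R]_n) :
  open V -> (forall y, U y -> V (g y)) -> smooth_on V A -> smooth_on U g ->
  smooth_on U (fun y => A (g y)).
Proof. move=> oV gUV sA sg r i j.
by apply: (C_on_comp oV oU gUV (sA r i j)) => l; exact: sg. Qed.

Lemma smooth_on_jac m (g : 'cV[R]_q -> 'cV[R]_m) :
  smooth_on U g -> smooth_on U (jac g).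
Proof.
move=> sg r i j; under eq_fun do rewrite mxE.
by have [_ /(_ j)[]] := sg r.+1 i 0.
Qed.

Lemma smooth_on_differentiable m k (A : 'cV[R]_q -> 'M[R]_(m, k)) y i j :
  smooth_on U A -> U y -> differentiable (fun z => A z i j) y.
Proof. by move=> sA; exact: C_on_differentiable (sA 1%N i j). Qed.

End SmoothMatrices.

Lemma smooth_onS (R : realType) q m k (U V : set 'cV[R]_q) (A : 'cV[R]_q -> 'M[R]_(m, k)) :
  V `<=` U -> smooth_on U A -> smooth_on V A.
Proof. by move=> VU sA r i j; exact: C_onS (sA r i j). Qed.

Lemma smooth_on_local (R : realType) q m k (U : set 'cV[R]_q) (A : 'cV[R]_q -> 'M[R]_(m, k)) :
  (forall y, U y -> exists2 V, V y & smooth_on V A) -> smooth_on U A.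
Proof.
move=> H r i j; apply: C_on_local => y /H[V Vy sA]; exists V => //; exact: sA.
Qed.

(** * Bump functions *)

Section FlatFunction.
Variable R : realType.

(* All derivatives of [exp(-1/x)] on the positive axis are of this form. *)
Definition flat (P : {poly R}) (x : R) : R :=
  if 0 < x then P.[x^-1] * expR (- x^-1) else 0.

(** With [y = 1/x >= 1] and [m = size P], the polynomial is at most [S y^m], while one term of the
    exponential series gives [exp(-y) <= (m+1)! / y^(m+1)]. The product is at most a constant times
    [1/y = x]. *)
Lemma flat_bound (P : {poly R}) : exists2 C : R, 0 <= C &
  forall x, x <= 1 -> `|flat P x| <= C * `|x|.
Proof.
pose S := \sum_(i < size P) `|P`_i|; pose m := size P.
exists (S * (m.+1)`!%:R); first by rewrite mulr_ge0// sumr_ge0.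
move=> x x1; rewrite /flat; case: ifPn => [x0|]; last first.
  by rewrite normr0 !mulr_ge0// sumr_ge0.
pose y := x^-1; rewrite -/y (gtr0_norm x0).
have y1 : 1 <= y by rewrite invf_ge1.
have y0 : 0 < y by rewrite (lt_le_trans ltr01).
have Py : `|P.[y]| <= S * y ^+ m.
  rewrite horner_coef mulr_suml (le_trans (ler_norm_sum _ _ _))//.
  apply: ler_sum => i _; rewrite normrM ler_wpM2l// ger0_norm; last by rewrite exprn_ge0// ltW.
  by apply: ler_weXn2l => //; exact: ltnW.
have ey : expR (- y) <= (m.+1)`!%:R / y ^+ m.+1.
  rewrite expRN -lef_pV2 ?posrE ?invr_gt0 ?expR_gt0 ?divr_gt0 ?exprn_gt0 ?ltr0n ?fact_gt0//.
  rewrite invrK invf_div; apply: le_trans (expR_ge1Dxn m (ltW y0)).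
  by rewrite lerDr.
rewrite normrM (ger0_norm (expR_ge0 _)).
apply: (@le_trans _ _ (S * y ^+ m * ((m.+1)`!%:R / y ^+ m.+1))).
  by rewrite ler_pM// expR_ge0.
have -> : x = y^-1 by rewrite invrK.
rewrite exprS invfM le_eqVlt; apply/orP; left; apply/eqP.
have ym : y ^+ m != 0 by rewrite expf_neq0// gt_eqF.
have yn : y != 0 by rewrite gt_eqF.
by move: ym; move: (y ^+ m) (_%:R) => ym f ym0; field; rewrite ym0 yn.
Qed.

Lemma flat_cvg0 (P : {poly R}) : flat P x @[x --> 0^'] --> 0.
Proof.
have [C C0 HC] := flat_bound P.
apply/cvgr0Pnorm_le => e e0; near=> x.
have x1 : `|x| < 1 by near: x; apply: dnbhs0_lt.
(* The constant [C] may vanish, hence the denominator [C + 1]. *)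
have xe : `|x| < e / (C + 1).
  by near: x; apply: dnbhs0_lt; rewrite divr_gt0// ltr_wpDl.
apply: le_trans (HC x _) _; first exact: le_trans (ler_norm x) (ltW x1).
have C1 : 0 < C + 1 by rewrite ltr_wpDl.
move: xe; rewrite ltr_pdivlMr// => /ltW; apply: le_trans.
by rewrite mulrC ler_wpM2l// lerDl.
Unshelve. all: by end_near. Qed.

(** For [x > 0] the derivative of [P(1/x) exp(-1/x)] is [x^-2 (P - P')(1/x) exp(-1/x)], again of the
    same form. At [0] the difference quotient is [flat ('X * P)], which tends to [0] by
    [flat_cvg0]. *)
Lemma is_derive_flat (P : {poly R}) (x : R) :
  is_derive x (1 : R) (flat P) (flat ('X^2 * (P - P^`())) x).
Proof.
have [x0|x0|->] := ltgtP x 0.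
- have fx : \near x, cst 0 x = flat P x.
    near=> z; have z0 : z < 0 by near: z; exact: lt_nbhsl.
    by rewrite /flat ltNge ltW.
  rewrite /flat ltNge ltW//=.
  by apply: (near_eq_is_derive fx); exact: is_derive_cst.
- have fx : \near x, P.[x^-1] * expR (- x^-1) = flat P x.
    near=> z; have z0 : 0 < z by near: z; exact: lt_nbhsr.
    by rewrite /flat z0.
  apply: (near_eq_is_derive fx); rewrite /flat x0.
  have x_neq0 : x != 0 by rewrite gt_eqF.
  have dV : is_derive x (1 : R) (fun z : R => z^-1) (- x ^- 2).
    have := @is_deriveV R id x 1 1 x_neq0 (is_derive_id _ _).
    by rewrite [_ *: 1]mulr1.
  have dP := is_derive1_comp (is_derive_poly P x^-1) dV.
  have dN := is_deriveN dV.
  have dE := @is_derive1_comp R expR (fun z => - z^-1) x _ _ (is_derive_expR _) dN.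
  have D : is_derive x (1 : R) (fun z : R => P.[z^-1] * expR (- z^-1)) _ :=
    is_deriveM dP dE.
  apply: (is_derive_eq D).
  rewrite !hornerE /= /GRing.scale /=.
  move: (expR _) (P.[_]) (P^`().[_]) => E a b.
  by field.
- have f0 Q : flat Q 0 = 0 by rewrite /flat ltxx.
  have E : \forall h \near (0 : R)^', flat ('X * P) h =
      h^-1 *: ((flat P \o shift 0) (h *: 1) - flat P 0).
    near=> h; rewrite f0 subr0 /= addr0 [h *: 1]mulr1 /flat.
    case: ifP => _; last by rewrite scaler0.
    by rewrite hornerM hornerX -mulrA.
  have L : h^-1 *: ((flat P \o shift 0) (h *: 1) - flat P 0) @[h --> (0 : R)^'] --> 0.
    exact: cvg_trans (near_eq_cvg E) (flat_cvg0 _).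
  by rewrite f0; split; [apply/cvg_ex; exists 0|exact: cvg_lim L].
Unshelve. all: by end_near. Qed.

Lemma flat_differentiable (P : {poly R}) (x : R) : differentiable (flat P) x.
Proof. by apply/derivable1_diffP; have [] := is_derive_flat P x. Qed.

Lemma C_on_flat (n r : nat) (U : set 'cV[R]_n) (f : 'cV[R]_n -> R) (P : {poly R}) :
  open U -> (forall r, C_on r U f) -> C_on r U (fun y => flat P (f y)).
Proof.
move=> oU Cf; elim: r P => [|r IH] P.
  split=> // y Uy; apply: continuous_comp; first exact: C_on_cont (Cf 0%N) Uy.
  exact/differentiable_continuous/flat_differentiable.
have df y : U y -> differentiable f y by move=> Uy; exact: C_on_differentiable (Cf 1%N) Uy.
split=> [y Uy|j].
  apply: continuous_comp; first exact: C_on_cont (Cf 0%N) Uy.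
  exact/differentiable_continuous/flat_differentiable.
split=> [y Uy|].
  apply: diff_derivable; apply: differentiable_comp; first exact: df.
  exact: flat_differentiable.
apply: (@C_on_eq _ _ _ _ (fun y => flat ('X^2 * (P - P^`())) (f y) * partial j f y)) => //.
  move=> y Uy; have dPf := flat_differentiable P (f y).
  have dc := differentiable_comp (df y Uy) dPf.
  rewrite /partial [RHS](deriveE _ dc).
  rewrite [in RHS](diff_comp (df y Uy) dPf) /= -(deriveE _ (df y Uy)).
  have [dflat dval] := is_derive_flat P (f y).
  by rewrite (deriv1E dflat) derive1E dval mulrC.
apply: C_onM => //.
by have [_ /(_ j)[]] := Cf r.+1.
Qed.

(** The bump is [exp(-1/psi)], set to zero where [psi <= 0] and normalised at [y0], with [psi] equal
    to [e^2] minus the squared Euclidean distance to [y0]. It vanishes outside the closed cube [K]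
    of half side [e]. *)
Lemma bump_exists (n : nat) (y0 : 'cV[R]_n) (O : set 'cV[R]_n) : open O -> O y0 ->
  exists (phi : 'cV[R]_n -> R) (K : set 'cV[R]_n),
    [/\ compact K, K `<=` O, forall r U, open U -> C_on r U phi, phi y0 = 1 &
        forall y, phi y != 0 -> K y].
Proof.
move=> oO Oy0.
have /nbhs_ballP[d /= d0 Hd] : nbhs y0 O by exact: open_nbhs_nbhs.
(* Balls are taken for the sup norm, so the closed cube of half side [d / 2] lies in the open ball
   of radius [d]. *)
pose e := d / 2.
have e0 : 0 < e by rewrite divr_gt0.
pose psi (y : 'cV[R]_n) := e ^+ 2 - \sum_i (y i 0 - y0 i 0) * (y i 0 - y0 i 0).
have psi0 : psi y0 = e ^+ 2.
  by rewrite /psi big1 ?subr0// => i _; rewrite subrr mul0r.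
have Cpsi r U : open U -> C_on r U psi.
  move=> oU; apply: C_onD => //; first exact: C_on_cst.
  have -> : (fun y : 'cV[R]_n => - (\sum_i (y i 0 - y0 i 0) * (y i 0 - y0 i 0))) =
     (fun y => -1 * \sum_i (y i 0 + - y0 i 0) * (y i 0 + - y0 i 0)).
    by apply/funext => y; rewrite mulN1r.
  apply: C_onM => //; first exact: C_on_cst.
  apply: C_on_sum => // i _.
  have Ci : C_on r U (fun y : 'cV[R]_n => y i 0 + - y0 i 0).
    by apply: C_onD => //; [exact: C_on_coord|exact: C_on_cst].
  exact: C_onM.
have f0 : 0 < flat 1 (psi y0).
  by rewrite psi0 /flat exprn_gt0// hornerE mul1r expR_gt0.
pose K := [set y : 'cV[R]_n | forall i, (y i 0) \in `[y0 i 0 - e, y0 i 0 + e]].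
exists (fun y => flat 1 (psi y) * (flat 1 (psi y0))^-1), K; split.
(* [K] is the transpose of a box of row vectors, which is compact as a product of segments. *)
- have KE : K = trmx @` [set v : 'rV[R]_n | forall i,
      `[y0 i 0 - e, y0 i 0 + e]%classic (v ord0 i)].
    apply/seteqP; split=> [y Ky|_ [v Hv <-] i]; last by rewrite mxE; exact: Hv.
    by exists y^T; rewrite ?trmxK// => i /=; rewrite mxE; exact: Ky.
  rewrite KE; apply: continuous_compact.
    apply: continuous_subspaceT => v; apply: continuous_mx => i j.
    have -> : (fun z : 'rV[R]_n => z^T i j) = (fun z => z j i).
      by apply/funext => z; rewrite mxE.
    exact: coord_continuous.
  apply: (@rV_compact _ _ (fun i => `[y0 i 0 - e, y0 i 0 + e]%classic)) => i.
  exact: segment_compact.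
- move=> y Ky; apply: Hd; rewrite -ball_normE /=.
  apply: (@le_lt_trans _ _ e); last by rewrite /e; lra.
  apply: mx_norm_leP; first exact: ltW.
  move=> i j; rewrite ord1 !mxE distrC ler_distl.
  by have := Ky i; rewrite in_itv.
- move=> r U oU; apply: C_onM => //; last exact: C_on_cst.
  by apply: C_on_flat => // r'; exact: Cpsi.
- by rewrite divff// gt_eqF.
- move=> y; rewrite mulf_eq0 negb_or => /andP[+ _].
  rewrite /flat; case: ifPn => [psiy _|]; last by rewrite eqxx.
  move=> i; rewrite in_itv /= -ler_distl.
  have : (y i 0 - y0 i 0) ^+ 2 < e ^+ 2.
    rewrite -subr_gt0; apply: lt_le_trans psiy _.
    rewrite lerD2l lerN2 (bigD1 i)//= -expr2 lerDl sumr_ge0// => k _.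
    by rewrite -expr2 sqr_ge0.
  rewrite -[X in X < _]real_normK ?num_real// => /ltW.
  by rewrite ler_pXn2r// nnegrE ?normr_ge0// ltW.
Qed.

End FlatFunction.

(** * Symmetry of second derivatives *)

Section Schwarz.
Variables (R : realType) (n : nat).
Implicit Types (f : 'cV[R]_n -> R).

Lemma derive_shift_arg f (v z w : 'cV[R]_n) :
  (derivable (fun z : 'cV[R]_n => f (z + v)) z w <-> derivable f (z + v) w) /\
  'D_w (fun z : 'cV[R]_n => f (z + v)) z = 'D_w f (z + v).
Proof.
have E : (fun h : R => h^-1 *:
    (((fun z : 'cV[R]_n => f (z + v)) \o shift z) (h *: w) - f (z + v)))
    = (fun h => h^-1 *: ((f \o shift (z + v)) (h *: w) - f (z + v))).
  by apply/funext => h /=; rewrite addrA.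
by rewrite /derivable /derive /= E.
Qed.

Lemma derivable_partialB (f1 f2 : 'cV[R]_n -> R) l y :
  derivable f1 y (delta_mx l 0) -> derivable f2 y (delta_mx l 0) ->
  partial l (fun z => f1 z - f2 z) y = partial l f1 y - partial l f2 y.
Proof. by move=> d1 d2; rewrite /partial -deriveB. Qed.

Lemma partial_increment f (v y : 'cV[R]_n) l :
  derivable f (y + v) (delta_mx l 0) -> derivable f y (delta_mx l 0) ->
  partial l (fun z : 'cV[R]_n => f (z + v) - f z) y = partial l f (y + v) - partial l f y.
Proof.
move=> d1 d2; have [d1' E] := derive_shift_arg f v y (delta_mx l 0).
exact: etrans (derivable_partialB (d1'.2 d1) d2) (congr1 (fun a => a - _) E).
Qed.

Lemma norm_sub_half (a b c e : R) :
  `|a - c| < e / 2 -> `|b - c| < e / 2 -> `|a - b| <= e.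
Proof.
move=> h1 h2; rewrite -(subrKA c) (le_trans (ler_normD _ _))//.
by rewrite [e]splitr lerD// ltW// distrC.
Qed.

(** The mixed second difference of [f] at [y], symmetric in the increments [u] and [v]. *)
Definition sdiff f (y u v : 'cV[R]_n) : R :=
  f (y + u + v) - f (y + u) - (f (y + v) - f y).

Lemma sdiffC f (y u v : 'cV[R]_n) : sdiff f y u v = sdiff f y v u.
Proof.
rewrite /sdiff (_ : y + v + u = y + u + v); last exact: addrAC.
by move: (f _) (f _) (f _) (f _) => a b c d; ring.
Qed.

(** Two uses of the mean value theorem: in the direction [i] for the increment
    [z |-> f (z + t e_j) - f z], then in the direction [j] for [partial i f]. The condition
    [t + t < d] keeps all points in the ball. *)
Lemma second_difference f (y : 'cV[R]_n) (d t : R) (i j : 'I_n) :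
  0 < t -> t + t < d ->
  (forall z, ball y d z -> derivable f z (delta_mx i 0) /\
     derivable (partial i f) z (delta_mx j 0)) ->
  exists2 z, ball y d z &
    sdiff f y (t *: delta_mx i 0) (t *: delta_mx j 0) = partial j (partial i f) z * t * t.
Proof.
move=> t0 td df.
have delta_le (k : 'I_n) (s : R) : `|s| <= t ->
    `|s *: (delta_mx k 0 : 'cV[R]_n)| <= t.
  move=> st; apply: mx_norm_leP; first exact: ltW.
  move=> a b; rewrite !mxE; apply: le_trans st; rewrite normrM ler_piMr//.
  by case: (_ && _); rewrite ?normr1 ?normr0.
have inb (s s' : R) : `|s| <= t -> `|s'| <= t ->
    ball y d (y + s *: delta_mx i 0 + s' *: delta_mx j 0).
  move=> st s't; rewrite -ball_normE/= -addrA opprD addNKr normrN.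
  apply: le_lt_trans td; apply: le_trans (ler_normD _ _) _.
  by apply: lerD; exact: delta_le.
have tt : `|t| <= t by rewrite gtr0_norm.
pose g (z : 'cV[R]_n) : R := f (z + t *: delta_mx j 0) - f z.
have inb0 (s : R) : `|s| <= t -> ball y d (y + s *: delta_mx i 0).
  move=> st; rewrite -[X in ball _ _ X]addr0 -(scale0r (delta_mx j 0)).
  by apply: inb => //; rewrite normr0 ltW.
have dg (s : R) : `|s| <= t ->
   derivable g (y + s *: delta_mx i 0) (delta_mx i 0).
  move=> st; apply: derivableB; last exact: (df _ (inb0 _ st)).1.
  apply/(derive_shift_arg f (t *: delta_mx j 0) _ _).1.
  exact: (df _ (inb _ _ st tt)).1.
have [|c ct E] := @coord_MVT _ _ g y i t.
  by rewrite gtr0_norm.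
rewrite (gtr0_norm t0) in ct.
have pg : partial i g (y + c *: delta_mx i 0) =
    partial i f (y + c *: delta_mx i 0 + t *: delta_mx j 0)
    - partial i f (y + c *: delta_mx i 0).
  apply: partial_increment; first exact: (df _ (inb _ _ ct tt)).1.
  exact: (df _ (inb0 _ ct)).1.
have [|c' ct' E'] := @coord_MVT _ _ (partial i f) (y + c *: delta_mx i 0) j t.
  move=> s; rewrite (gtr0_norm t0) => st; exact: (df _ (inb _ _ ct st)).2.
rewrite (gtr0_norm t0) in ct'.
exists (y + c *: delta_mx i 0 + c' *: delta_mx j 0); first exact: inb.
by rewrite -E' -pg -E.
Qed.

(** The same second difference, divided by [t^2], is a value of either mixed derivative at some
    point near [y]. By continuity both values at [y] are within [e / 2] of this number, for every
    [e]. *)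
Lemma Schwarz (U : set 'cV[R]_n) f y (i j : 'I_n) : open U -> C_on 2 U f -> U y ->
  partial j (partial i f) y = partial i (partial j f) y.
Proof.
move=> oU [_ Cf] Uy.
have dd k l z : U z -> derivable f z (delta_mx k 0) /\
    derivable (partial k f) z (delta_mx l 0).
  by move=> Uz; have [df [_ /(_ l)[ddf _]]] := Cf k; split; [exact: df|exact: ddf].
have cc k l : {for y, continuous (partial l (partial k f))}.
  by have [_ [_ /(_ l)[_ [+ _]]]] := Cf k; apply.
apply/eqP; rewrite -subr_eq0 -normr_le0; apply/ler_addgt0Pr => e e0; rewrite add0r.
have e2 : 0 < e / 2 by rewrite divr_gt0.
have nU : \forall z \near y, U z by exact: open_nbhs_nbhs.
have n1 : \forall z \near y,
    `|partial j (partial i f) y - partial j (partial i f) z| < e / 2.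
  exact: ((cvgrPdist_lt (partial j (partial i f)) _).1 (cc i j) _ e2).
have n2 : \forall z \near y,
    `|partial i (partial j f) y - partial i (partial j f) z| < e / 2.
  exact: ((cvgrPdist_lt (partial i (partial j f)) _).1 (cc j i) _ e2).
have : \forall z \near y, [/\ U z,
    `|partial j (partial i f) y - partial j (partial i f) z| < e / 2 &
    `|partial i (partial j f) y - partial i (partial j f) z| < e / 2].
  move: n2; apply: filter_app; move: n1; apply: filter_app; move: nU.
  by apply: filterS => z h0 h1 h2; split.
move=> /nbhs_ballP[d /= d0 Hd].
pose t := d / 3.
have t0 : 0 < t by rewrite divr_gt0.
have td : t + t < d by rewrite /t; lra.
have [|z1 bz1 E1] := @second_difference f y d t i j t0 td.
  by move=> z /Hd[Uz _ _]; exact: dd.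
have [|z2 bz2 E2] := @second_difference f y d t j i t0 td.
  by move=> z /Hd[Uz _ _]; exact: dd.
move=> {dd cc nU n1 n2 Cf}.
have E : partial j (partial i f) z1 = partial i (partial j f) z2.
  apply: (mulIf (lt0r_neq0 t0)); apply: (mulIf (lt0r_neq0 t0)).
  exact: etrans (esym E1) (etrans (sdiffC _ _ _ _) E2).
have [_ h1 _] := Hd _ bz1; have [_ _ h2] := Hd _ bz2.
move=> {Hd bz1 bz2 E1 E2}.
rewrite E in h1.
exact: norm_sub_half h1 h2.
Qed.

End Schwarz.

Local Open Scope complex_scope.

(** * Complex-valued functions of real variables *)

Section ComplexCalculus.
Variable R : realType.

Lemma Re_add (x z : R[i]) : complex.Re (x + z) = complex.Re x + complex.Re z.
Proof. by case: x; case: z. Qed.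

Lemma Im_add (x z : R[i]) : complex.Im (x + z) = complex.Im x + complex.Im z.
Proof. by case: x; case: z. Qed.

Lemma Re_mul (x z : R[i]) : complex.Re (x * z) =
  complex.Re x * complex.Re z - complex.Im x * complex.Im z.
Proof. by case: x; case: z. Qed.

Lemma Im_mul (x z : R[i]) : complex.Im (x * z) =
  complex.Re x * complex.Im z + complex.Im x * complex.Re z.
Proof. by case: x; case: z. Qed.

Lemma Re_sum (I : Type) (s : seq I) (P : pred I) (f : I -> R[i]) :
  complex.Re (\sum_(k <- s | P k) f k) = \sum_(k <- s | P k) complex.Re (f k).
Proof. exact: (big_morph _ Re_add). Qed.

Lemma Im_sum (I : Type) (s : seq I) (P : pred I) (f : I -> R[i]) :
  complex.Im (\sum_(k <- s | P k) f k) = \sum_(k <- s | P k) complex.Im (f k).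
Proof. exact: (big_morph _ Im_add). Qed.

Lemma complex_ext (x z : R[i]) : complex.Re x = complex.Re z ->
  complex.Im x = complex.Im z -> x = z.
Proof. by case: x; case: z => a b c d /= -> ->. Qed.

Section OneDomain.
Variable q : nat.
Implicit Types (g h : 'cV[R]_q -> R[i]) (y : 'cV[R]_q) (l : 'I_q).

Definition cpartial l g y : R[i] :=
  Complex (partial l (fun z => complex.Re (g z)) y)
          (partial l (fun z => complex.Im (g z)) y).

Definition cdifferentiable g y :=
  differentiable (fun z => complex.Re (g z)) y /\
  differentiable (fun z => complex.Im (g z)) y.

Lemma partialD (f1 f2 : 'cV[R]_q -> R) l y :
  differentiable f1 y -> differentiable f2 y ->
  partial l (fun z => f1 z + f2 z) y = partial l f1 y + partial l f2 y.
Proof. by move=> d1 d2; rewrite /partial -deriveD//; exact: diff_derivable. Qed.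

Lemma partialB (f1 f2 : 'cV[R]_q -> R) l y :
  differentiable f1 y -> differentiable f2 y ->
  partial l (fun z => f1 z - f2 z) y = partial l f1 y - partial l f2 y.
Proof. by move=> d1 d2; rewrite /partial -deriveB//; exact: diff_derivable. Qed.

Lemma partialM (f1 f2 : 'cV[R]_q -> R) l y :
  differentiable f1 y -> differentiable f2 y ->
  partial l (fun z => f1 z * f2 z) y =
    f1 y * partial l f2 y + f2 y * partial l f1 y.
Proof.
move=> d1 d2; rewrite /partial.
rewrite -[RHS]/(f1 y *: 'D_(delta_mx l 0) f2 y + f2 y *: 'D_(delta_mx l 0) f1 y).
by rewrite -deriveM//; exact: diff_derivable.
Qed.

Lemma cdifferentiable_cst (c : R[i]) y : cdifferentiable (fun=> c) y.
Proof. by split; exact: differentiable_cst. Qed.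

Lemma cdifferentiableD g h y : cdifferentiable g y -> cdifferentiable h y ->
  cdifferentiable (fun z => g z + h z) y.
Proof.
move=> [dg dg'] [dh dh']; split.
- by under eq_fun do rewrite Re_add; exact: differentiableD.
- by under eq_fun do rewrite Im_add; exact: differentiableD.
Qed.

Lemma cpartialD g h y l : cdifferentiable g y -> cdifferentiable h y ->
  cpartial l (fun z => g z + h z) y = cpartial l g y + cpartial l h y.
Proof.
move=> [dg dg'] [dh dh']; apply: complex_ext.
- by rewrite Re_add /= -partialD//; under eq_fun do rewrite Re_add.
- by rewrite Im_add /= -partialD//; under eq_fun do rewrite Im_add.
Qed.

Lemma cdifferentiableM g h y : cdifferentiable g y -> cdifferentiable h y ->
  cdifferentiable (fun z => g z * h z) y.
Proof.
move=> [dg dg'] [dh dh']; split.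
- under eq_fun do rewrite Re_mul.
  by apply: differentiableB; exact: differentiableM.
- under eq_fun do rewrite Im_mul.
  by apply: differentiableD; exact: differentiableM.
Qed.

Lemma cpartialM g h y l : cdifferentiable g y -> cdifferentiable h y ->
  cpartial l (fun z => g z * h z) y = cpartial l g y * h y + g y * cpartial l h y.
Proof.
move=> [dg dg'] [dh dh']; apply: complex_ext.
- rewrite Re_add !Re_mul /=; under eq_fun do rewrite Re_mul.
  rewrite partialB ?partialM//; try exact: differentiableM.
  ring.
- rewrite Im_add !Im_mul /=; under eq_fun do rewrite Im_mul.
  rewrite partialD ?partialM//; try exact: differentiableM.
  ring.
Qed.

Lemma cpartial_cst (c : R[i]) l y : cpartial l (fun=> c) y = 0.
Proof. by rewrite /cpartial /partial; congr Complex; exact: derive_cst. Qed.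

Lemma cdifferentiable_sum (I : Type) (s : seq I) (P : pred I)
    (g : I -> 'cV[R]_q -> R[i]) y : (forall k, cdifferentiable (g k) y) ->
  cdifferentiable (fun z => \sum_(k <- s | P k) g k z) y.
Proof.
move=> dg; elim: s => [|k s IH].
  by under eq_fun do rewrite big_nil; exact: cdifferentiable_cst.
under eq_fun do rewrite big_cons.
by case: (P k) => //; exact: cdifferentiableD.
Qed.

Lemma cpartial_sum (I : Type) (s : seq I) (P : pred I)
    (g : I -> 'cV[R]_q -> R[i]) l y : (forall k, cdifferentiable (g k) y) ->
  cpartial l (fun z => \sum_(k <- s | P k) g k z) y =
  \sum_(k <- s | P k) cpartial l (g k) y.
Proof.
move=> dg; elim: s => [|k s IH].
  by under eq_fun do rewrite big_nil; rewrite big_nil cpartial_cst.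
under eq_fun do rewrite big_cons.
rewrite big_cons; case: (P k) => //; rewrite cpartialD ?IH//.
exact: cdifferentiable_sum.
Qed.

Lemma cpartial_eq g h y l : (\near y, g y = h y) -> cpartial l g y = cpartial l h y.
Proof.
move=> gh; congr Complex; apply: near_eq_derive; apply: filterS gh => z ->//.
Qed.

End OneDomain.

Lemma cpartial_comp p n (g : 'cV[R]_n -> R[i]) (f : 'cV[R]_p -> 'cV[R]_n) y l :
  cdifferentiable g (f y) -> (forall k, differentiable (fun z => f z k 0) y) ->
  cpartial l (fun z => g (f z)) y =
    \sum_k cpartial k g (f y) * (partial l (fun z => f z k 0) y)%:C.
Proof.
move=> [dg dg'] df; apply: complex_ext.
- rewrite Re_sum.
  apply: etrans (partial_comp (f := fun z => complex.Re (g z)) l dg df) _.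
  by apply: eq_bigr => k _; rewrite Re_mul /= mulr0 subr0.
- rewrite Im_sum.
  apply: etrans (partial_comp (f := fun z => complex.Im (g z)) l dg' df) _.
  by apply: eq_bigr => k _; rewrite Im_mul /= mulr0 add0r.
Qed.

Lemma cdifferentiable_comp p n (g : 'cV[R]_n -> R[i]) (f : 'cV[R]_p -> 'cV[R]_n) y :
  cdifferentiable g (f y) -> (forall k, differentiable (fun z => f z k 0) y) ->
  cdifferentiable (fun z => g (f z)) y.
Proof.
move=> [dg dg'] df; have dfy := differentiable_cV df.
by split; [exact: (differentiable_comp dfy dg)|exact: (differentiable_comp dfy dg')].
Qed.

End ComplexCalculus.

(** The componentwise derivative [D_X A], linear over the complex numbers in the direction [X]. It
    is locked so that it stays folded during rewriting. *)
HB.lock Definition dirC (R : realType) (q m k : nat)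
    (A : 'cV[R]_q -> 'M[R[i]]_(m, k)) (y : 'cV[R]_q) (X : 'cV[R[i]]_q) :
    'M[R[i]]_(m, k) :=
  \matrix_(i, j) \sum_l cpartial l (fun z => A z i j) y * X l 0.

Section ComplexMatrixCalculus.
Variable R : realType.

Definition mx_cdiff (q m k : nat) (A : 'cV[R]_q -> 'M[R[i]]_(m, k)) y :=
  forall i j, cdifferentiable (fun z => A z i j) y.

Lemma dirCE (q m k : nat) (A : 'cV[R]_q -> 'M[R[i]]_(m, k)) y X i j :
  dirC A y X i j = \sum_l cpartial l (fun z => A z i j) y * X l 0.
Proof. by rewrite dirC.unlock mxE. Qed.

Lemma jacCE (q m : nat) (F : 'cV[R]_q -> 'cV[R[i]]_m) y i l :
  jacC F y i l = cpartial l (fun z => F z i 0) y.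
Proof.
have ER : (fun z => Defs.ReM (F z) i 0) = (fun z => complex.Re (F z i 0)).
  by apply/funext => z; rewrite mxE.
have EI : (fun z => Defs.ImM (F z) i 0) = (fun z => complex.Im (F z i 0)).
  by apply/funext => z; rewrite mxE.
rewrite !mxE ER EI.
by apply: complex_ext; rewrite /= ?Re_add ?Im_add ?Re_mul ?Im_mul /=; ring.
Qed.

Section OneDomain.
Variable q : nat.
Implicit Types (y : 'cV[R]_q) (X : 'cV[R[i]]_q).

Lemma jacC_dirC m (F : 'cV[R]_q -> 'cV[R[i]]_m) y X : jacC F y *m X = dirC F y X.
Proof.
apply/matrixP => i j; rewrite ord1 mxE dirCE.
by apply: eq_bigr => l _; rewrite jacCE.
Qed.

Lemma dirC_eq m k (A B : 'cV[R]_q -> 'M[R[i]]_(m, k)) y X :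
  (\near y, A y = B y) -> dirC A y X = dirC B y X.
Proof.
move=> AB; apply/matrixP => i j; rewrite !dirCE; apply: eq_bigr => l _.
by congr (_ * _); apply: cpartial_eq; apply: filterS AB => z ->.
Qed.

Lemma dirC_cst m k (A : 'M[R[i]]_(m, k)) y X : dirC (fun=> A) y X = 0.
Proof.
apply/matrixP => i j; rewrite dirCE mxE big1// => l _.
by rewrite cpartial_cst mul0r.
Qed.

Lemma dirCM m k r (A : 'cV[R]_q -> 'M[R[i]]_(m, k))
    (B : 'cV[R]_q -> 'M[R[i]]_(k, r)) y X :
  mx_cdiff A y -> mx_cdiff B y ->
  dirC (fun z => A z *m B z) y X = dirC A y X *m B y + A y *m dirC B y X.
Proof.
move=> dA dB; apply/matrixP => i j; rewrite dirCE !mxE.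
have dAB s : cdifferentiable (fun z => A z i s * B z s j) y.
  by apply: cdifferentiableM.
under eq_bigr => l _.
  under eq_fun do rewrite mxE.
  rewrite cpartial_sum//.
  under eq_bigr do rewrite cpartialM//.
  rewrite big_split mulrDl /= !mulr_suml; over.
rewrite big_split /= exchange_big [in X in _ + X]exchange_big /=.
congr (_ + _); apply: eq_bigr => s _; rewrite dirCE.
- by rewrite mulr_suml; apply: eq_bigr => l _; rewrite mulrAC.
- by rewrite mulr_sumr; apply: eq_bigr => l _; rewrite mulrA.
Qed.

Lemma dirCD m k (A B : 'cV[R]_q -> 'M[R[i]]_(m, k)) y X :
  mx_cdiff A y -> mx_cdiff B y ->
  dirC (fun z => A z + B z) y X = dirC A y X + dirC B y X.
Proof.
move=> dA dB; apply/matrixP => i j; rewrite mxE !dirCE -big_split /=.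
apply: eq_bigr => l _; under eq_fun do rewrite mxE.
by rewrite cpartialD// mulrDl.
Qed.

Lemma dirC_mxsub m k m' k' f g (A : 'cV[R]_q -> 'M[R[i]]_(m, k)) y X :
  dirC (fun z => mxsub f g (A z) : 'M[R[i]]_(m', k')) y X = mxsub f g (dirC A y X).
Proof.
apply/matrixP => i j; rewrite mxE !dirCE; apply: eq_bigr => l _.
by under eq_fun do rewrite mxE.
Qed.

Lemma dirC_tr m k (A : 'cV[R]_q -> 'M[R[i]]_(m, k)) y X :
  dirC (fun z => (A z)^T) y X = (dirC A y X)^T.
Proof.
apply/matrixP => i j; rewrite mxE !dirCE; apply: eq_bigr => l _.
by under eq_fun do rewrite mxE.
Qed.

Lemma mx_cdiff_cst m k (A : 'M[R[i]]_(m, k)) y : mx_cdiff (fun=> A) y.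
Proof. by move=> i j; exact: cdifferentiable_cst. Qed.

Lemma mx_cdiffM m k r (A : 'cV[R]_q -> 'M[R[i]]_(m, k))
    (B : 'cV[R]_q -> 'M[R[i]]_(k, r)) y :
  mx_cdiff A y -> mx_cdiff B y -> mx_cdiff (fun z => A z *m B z) y.
Proof.
move=> dA dB i j; under eq_fun do rewrite mxE.
by apply: cdifferentiable_sum => s; exact: cdifferentiableM.
Qed.

Lemma mx_cdiff_mxsub m k m' k' f g (A : 'cV[R]_q -> 'M[R[i]]_(m, k)) y :
  mx_cdiff A y -> mx_cdiff (fun z => mxsub f g (A z) : 'M[R[i]]_(m', k')) y.
Proof. by move=> dA i j; under eq_fun do rewrite mxE; exact: dA. Qed.

Lemma mx_cdiff_tr m k (A : 'cV[R]_q -> 'M[R[i]]_(m, k)) y :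
  mx_cdiff A y -> mx_cdiff (fun z => (A z)^T) y.
Proof. by move=> dA i j; under eq_fun do rewrite mxE; exact: dA. Qed.

Lemma smoothC_cdiff m k (U : set 'cV[R]_q) (A : 'cV[R]_q -> 'M[R[i]]_(m, k)) y :
  open U -> U y -> smoothC_on U A -> mx_cdiff A y.
Proof.
move=> oU Uy [sR sI] i j; split.
- by have := smooth_on_differentiable oU i j sR Uy; under eq_fun do rewrite mxE.
- by have := smooth_on_differentiable oU i j sI Uy; under eq_fun do rewrite mxE.
Qed.

Lemma smoothC_complexify m k (U : set 'cV[R]_q) (A : 'cV[R]_q -> 'M[R]_(m, k)) :
  open U -> smooth_on U A -> smoothC_on U (fun z => complexify (A z)).
Proof.
move=> oU sA; split.
- by apply: (smooth_on_eq oU _ sA) => z _; apply/matrixP => i j; rewrite !mxE.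
- apply: (@smooth_on_eq R q U oU m k (fun=> 0)); last exact: smooth_on_cst.
  by move=> z _; apply/matrixP => i j; rewrite !mxE.
Qed.

End OneDomain.

Lemma dirC_comp (p n m k : nat) (A : 'cV[R]_n -> 'M[R[i]]_(m, k))
    (f : 'cV[R]_p -> 'cV[R]_n) y X :
  mx_cdiff A (f y) -> (forall k, differentiable (fun z => f z k 0) y) ->
  dirC (fun z => A (f z)) y X = dirC A (f y) (complexify (jac f y) *m X).
Proof.
move=> dA df; apply/matrixP => i j; rewrite !dirCE.
under eq_bigr => l _.
  rewrite (cpartial_comp _ (dA i j) df) mulr_suml; over.
rewrite exchange_big /=; apply: eq_bigr => s _; rewrite mxE mulr_sumr.
by apply: eq_bigr => l _; rewrite !mxE mulrA.
Qed.

Lemma mx_cdiff_comp (p n m k : nat) (A : 'cV[R]_n -> 'M[R[i]]_(m, k))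
    (f : 'cV[R]_p -> 'cV[R]_n) y :
  mx_cdiff A (f y) -> (forall k, differentiable (fun z => f z k 0) y) ->
  mx_cdiff (fun z => A (f z)) y.
Proof. by move=> dA df i j; exact: cdifferentiable_comp (dA i j) df. Qed.

End ComplexMatrixCalculus.

(** * Linear generalized complex structures *)

(** Twice the neutral metric, over any field. Values are 1 x 1 matrices, so that pairings are
    ordinary matrix products. *)
HB.lock Definition pairing (K : fieldType) (n : nat) (u v : 'cV[K]_(n + n)) : 'M[K]_1 :=
  (dsubmx u)^T *m usubmx v + (dsubmx v)^T *m usubmx u.

Section MatrixFacts.
Variable K : fieldType.

Lemma mulmx_cV_ext (m n : nat) (A B : 'M[K]_(m, n)) :
  (forall v : 'cV[K]_n, A *m v = B *m v) -> A = B.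
Proof.
move=> AB; apply/matrixP => i j; have /matrixP/(_ i 0) := AB (delta_mx j 0).
by rewrite -!colE !mxE.
Qed.

Lemma unitmx_injective (n : nat) (A : 'M[K]_n) :
  (forall u : 'cV[K]_n, A *m u = 0 -> u = 0) -> A \in unitmx.
Proof.
move=> A0; rewrite -unitmx_tr -row_free_unit -kermx_eq0.
rewrite -[X in X == 0]trmxK trmx_eq0; apply/eqP/mulmx_cV_ext => v.
by rewrite mul0mx; apply: A0; rewrite mulmxA -{1}(trmxK A) -trmx_mul mulmx_ker trmx0 mul0mx.
Qed.

Lemma factor_range (m n k : nat) (A : 'M[K]_(m, n)) (S : 'M[K]_(m, k)) :
  (forall v : 'cV[K]_n, exists d : 'cV[K]_k, A *m v = S *m d) ->
  exists P, A = S *m P.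
Proof.
move=> AS; have [d Hd] := choice (fun j => AS (delta_mx j 0)).
exists (\matrix_(i, j) d j i 0); apply/matrixP => i j.
have /matrixP/(_ i 0) := Hd j; rewrite -colE !mxE => ->.
by apply: eq_bigr => l _; rewrite mxE.
Qed.

Definition gram (n : nat) : 'M[K]_(n + n) := block_mx 0 1%:M 1%:M 0.

Lemma pairingE n (u v : 'cV[K]_(n + n)) :
  pairing u v = (dsubmx u)^T *m usubmx v + (dsubmx v)^T *m usubmx u.
Proof. by rewrite pairing.unlock. Qed.

Lemma pairingC n (u v : 'cV[K]_(n + n)) : pairing u v = pairing v u.
Proof. by rewrite !pairingE addrC. Qed.

Lemma pairing_gram n (u v : 'cV[K]_(n + n)) : pairing u v = u^T *m gram n *m v.
Proof.
rewrite -{2}(vsubmxK u) -{2}(vsubmxK v) tr_col_mx /gram mul_row_block.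
rewrite !mulmx0 !mulmx1 add0r addr0 mul_row_col pairingE; congr (_ + _).
by apply/matrixP => i j; rewrite !ord1 !mxE; apply: eq_bigr => l _; rewrite !mxE mulrC.
Qed.

Lemma pairingDl n (u u' v : 'cV[K]_(n + n)) :
  pairing (u + u') v = pairing u v + pairing u' v.
Proof. by rewrite !pairing_gram raddfD /= !mulmxDl. Qed.

Lemma pairingDr n (u v v' : 'cV[K]_(n + n)) :
  pairing u (v + v') = pairing u v + pairing u v'.
Proof. by rewrite !pairing_gram mulmxDr. Qed.

Lemma pairingZl n a (u v : 'cV[K]_(n + n)) : pairing (a *: u) v = a *: pairing u v.
Proof. by rewrite !pairing_gram linearZ /= -!scalemxAl. Qed.

Lemma pairingZr n a (u v : 'cV[K]_(n + n)) : pairing u (a *: v) = a *: pairing u v.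
Proof. by rewrite !pairing_gram -scalemxAr. Qed.

Lemma gram_gram n : gram n *m gram n = 1%:M.
Proof.
rewrite /gram mulmx_block !mulmx0 !mul0mx !mulmx1 !add0r addr0.
by rewrite -scalar_mx_block.
Qed.

End MatrixFacts.

Section ComplexMatrices.
Variable R : realType.

Lemma complexifyM m n k (A : 'M[R]_(m, n)) (B : 'M[R]_(n, k)) :
  complexify (A *m B) = complexify A *m complexify B.
Proof. exact: map_mxM. Qed.

Lemma complexifyN m n (A : 'M[R]_(m, n)) : complexify (- A) = - complexify A.
Proof. exact: map_mxN. Qed.

Lemma complexify1 n : complexify (1%:M : 'M[R]_n) = 1%:M.
Proof. exact: map_mx1. Qed.

Lemma complexify_tr m n (A : 'M[R]_(m, n)) : complexify A^T = (complexify A)^T.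
Proof. by rewrite /complexify map_trmx. Qed.

Lemma complexify_col_mx m1 m2 n (A : 'M[R]_(m1, n)) (B : 'M[R]_(m2, n)) :
  complexify (col_mx A B) = col_mx (complexify A) (complexify B).
Proof. exact: map_col_mx. Qed.

Lemma complexify_usubmx m1 m2 n (A : 'M[R]_(m1 + m2, n)) :
  complexify (usubmx A) = usubmx (complexify A).
Proof. exact: map_usubmx. Qed.

Lemma complexify_dsubmx m1 m2 n (A : 'M[R]_(m1 + m2, n)) :
  complexify (dsubmx A) = dsubmx (complexify A).
Proof. exact: map_dsubmx. Qed.

(** Splits a complex eigenvector equation into two real equations. *)
Lemma complexify_inj m n (A B A' B' : 'M[R]_(m, n)) :
  complexify A + 'i%C *: complexify B = complexify A' + 'i%C *: complexify B' ->
  A = A' /\ B = B'.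
Proof.
move=> /matrixP H; split; apply/matrixP => i j; have := H i j; rewrite !mxE.
- by move=> /(congr1 (@complex.Re R)); rewrite !Re_add !Re_mul /= => H1; lra.
- by move=> /(congr1 (@complex.Im R)); rewrite !Im_add !Im_mul /= => H1; lra.
Qed.

Lemma complexify_Re_Im m n (A : 'M[R[i]]_(m, n)) :
  A = complexify (Defs.ReM A) + 'i%C *: complexify (Defs.ImM A).
Proof. by apply/matrixP => i j; rewrite !mxE -complexE. Qed.

Lemma ii_scale m n (A : 'M[R[i]]_(m, n)) : 'i%C *: ('i%C *: A) = - A.
Proof. by rewrite scalerA -expr2 sqr_i scaleN1r. Qed.

Section Gcs.
Variable n : nat.
Implicit Types (J : 'M[R]_(n + n)) (u v : 'cV[R[i]]_(n + n)).

Lemma linear_gcs_sq J : linear_gcs J -> J *m J = - 1%:M.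
Proof. by case. Qed.

Lemma linear_gcs_gram J : linear_gcs J -> gram R n *m J = - (J^T *m gram R n).
Proof.
move=> [_ H]; apply/eqP; rewrite -addr_eq0; apply/eqP.
apply: mulmx_cV_ext => v; rewrite mul0mx.
rewrite -[LHS]trmxK; apply/eqP; rewrite trmx_eq0; apply/eqP.
apply: mulmx_cV_ext => u; rewrite mul0mx.
have E (a b : 'cV[R]_(n + n)) : neutral_metric a b = 2^-1 * (pairing a b) 0 0.
  by rewrite /neutral_metric pairingE !mxE.
have Huv : pairing u (J *m v) + pairing (J *m u) v = 0.
  apply/matrixP => i j; rewrite !ord1 [LHS]mxE [RHS]mxE.
  have := H u v; rewrite !E -mulrDr => /eqP.
  by rewrite mulf_eq0 invr_eq0 pnatr_eq0 /= => /eqP.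
apply: trmx_inj; rewrite trmx_mul trmxK trmx0.
move: Huv; rewrite !pairing_gram trmx_mul => E0; rewrite -[RHS]E0.
by rewrite mulmxDl mulmxDr !mulmxA.
Qed.

(** This is the lower right block of the identity in [linear_gcs_gram]. *)
Lemma sharp_pi_skew J : linear_gcs J -> (sharp_pi J)^T = - sharp_pi J.
Proof.
move=> /linear_gcs_gram; rewrite -{1 2}(submxK J) /gram tr_block_mx !mulmx_block.
rewrite !mulmx0 !mul0mx !mul1mx !mulmx1 !add0r !addr0 opp_block_mx.
by move=> /eq_block_mx[_ _ _ E]; rewrite /sharp_pi [in RHS]E opprK.
Qed.

(** Twice the projector onto the i-eigenspace along its conjugate. *)
Definition proj_i J : 'M[R[i]]_(n + n) := 1%:M - 'i%C *: complexify J.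

Lemma proj_i_eigen J u : linear_gcs J -> i_eigenspace J (proj_i J *m u).
Proof.
move=> /linear_gcs_sq JJ; rewrite /i_eigenspace /= /proj_i mulmxA mulmxBr mulmx1.
rewrite -scalemxAr -complexifyM JJ complexifyN complexify1 scalerN opprK.
rewrite scalemxAl scalerBr ii_scale opprK; congr (_ *m _).
by rewrite addrC.
Qed.

Lemma complexify_gram : complexify (gram R n) = gram R[i] n.
Proof. by rewrite /gram /complexify map_block_mx !map_mx1 !map_mx0. Qed.

(** Skewness of [J] for the metric gives [2 i <u, v> = 0]. *)
Lemma eigen_isotropic J u v : linear_gcs J -> i_eigenspace J u ->
  i_eigenspace J v -> pairing u v = 0.
Proof.
move=> /linear_gcs_gram /(congr1 (@complexify R _ _)).
rewrite complexifyN !complexifyM complexify_gram complexify_tr => GJ Ju Jv.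
have : pairing u (complexify J *m v) + pairing (complexify J *m u) v = 0.
  rewrite !pairing_gram trmx_mul -!mulmxA [gram _ _ *m (_ *m _)]mulmxA GJ.
  by rewrite mulNmx mulmxN !mulmxA addNr.
rewrite Ju Jv pairingZl pairingZr -scalerDl.
move=> /eqP; rewrite scaler_eq0 => /orP[|/eqP//].
by rewrite eq_complex /= addr0 eqxx /= -mulr2n pnatr_eq0.
Qed.

(** It suffices that [u] be orthogonal to all [(1 - i J) v]. Moving the operator to the other side
    of the metric turns it into [1 + i J], and [(1 + i J) u = 0] means [J u = i u]. *)
Lemma eigen_maximal J u : linear_gcs J ->
  (forall v, i_eigenspace J v -> pairing u v = 0) -> i_eigenspace J u.
Proof.
move=> gJ H; have /(congr1 (@complexify R _ _)) := linear_gcs_gram gJ.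
rewrite complexifyN !complexifyM complexify_gram complexify_tr => GJ.
have uE : u^T *m gram R[i] n *m proj_i J = 0.
  apply: mulmx_cV_ext => v; rewrite mul0mx -[X in X = _]mulmxA -pairing_gram.
  exact: H (proj_i_eigen _ gJ).
have GE : gram R[i] n *m proj_i J =
    (1%:M + 'i%C *: complexify J)^T *m gram R[i] n.
  have trZ : ('i%C *: complexify J)^T = 'i%C *: (complexify J)^T by exact: linearZ.
  rewrite /proj_i mulmxBr mulmx1 -scalemxAr GJ raddfD /= trZ trmx1.
  by rewrite mulmxDl mul1mx -scalemxAl scalerN opprK.
move: uE; rewrite -mulmxA GE mulmxA => /(congr1 (mulmxr (gram R[i] n))) /=.
rewrite mul0mx -(mulmxA _ (gram R[i] n)) gram_gram mulmx1 -trmx_mul => /(congr1 trmx).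
rewrite trmxK trmx0 mulmxDl mul1mx -scalemxAl => /(congr1 ( *:%R 'i%C)).
rewrite scalerDr ii_scale scaler0 => /eqP; rewrite subr_eq0 => /eqP E.
by rewrite /i_eigenspace /= E.
Qed.

End Gcs.

Section Induced.
Variables (n p : nat) (F : 'M[R]_(n, p)) (J : 'M[R]_(n + n)) (Jt : 'M[R]_(p + p)).
Hypotheses (gJ : linear_gcs J) (iJ : induced_structure F J Jt).

Lemma induced_equivariant (X Y : 'cV[R]_p) (eta zeta : 'cV[R]_n) :
  J *m col_mx (F *m X) eta = col_mx (F *m Y) zeta ->
  Jt *m col_mx X (F^T *m eta) = col_mx Y (F^T *m zeta).
Proof.
set a := col_mx X _; set b := col_mx Y _ => E.
have E' : J *m col_mx (F *m Y) zeta = - col_mx (F *m X) eta.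
  by rewrite -E mulmxA (linear_gcs_sq gJ) mulNmx mul1mx.
have : i_eigenspace Jt (complexify a + 'i%C *: complexify (- b)).
  case: iJ => _ ->; exists (complexify X + 'i%C *: complexify (- Y)).
  exists (complexify eta + 'i%C *: complexify (- zeta)); split.
    rewrite mulmxDr -scalemxAr -complexify_tr -!complexifyM mulmxN.
    by rewrite /a /b -add_col_mx -scale_col_mx -!complexify_col_mx opp_col_mx.
  rewrite mulmxDr -scalemxAr -!complexifyM mulmxN.
  rewrite -add_col_mx -scale_col_mx -!complexify_col_mx -opp_col_mx.
  rewrite /i_eigenspace /= mulmxDr -scalemxAr -!complexifyM mulmxN E E' opprK.
  by rewrite scalerDr ii_scale complexifyN opprK addrC.
rewrite /i_eigenspace /= mulmxDr -scalemxAr -!complexifyM scalerDr ii_scale.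
rewrite complexifyN opprK [RHS]addrC.
by move=> /complexify_inj[].
Qed.

(** The vector [(1 - i Jt)(X, xi)] is the pullback of some element of L. The real part of that
    element is the desired lift, and [J] sends it to minus the imaginary part, which is again
    tangent to the subspace. *)
Lemma induced_lift_ex (X xi : 'cV[R]_p) :
  exists (eta : 'cV[R]_n) (Y : 'cV[R]_p) (zeta : 'cV[R]_n),
  F^T *m eta = xi /\ J *m col_mx (F *m X) eta = col_mx (F *m Y) zeta.
Proof.
case: iJ => gJt HL; set a := col_mx X xi.
have : i_eigenspace Jt (proj_i Jt *m complexify a) by exact: proj_i_eigen.
rewrite HL => -[X' [eta' []]].
rewrite (complexify_Re_Im X') (complexify_Re_Im eta').
set X1 := Defs.ReM X'; set X2 := Defs.ImM X'.
set e1 := Defs.ReM eta'; set e2 := Defs.ImM eta'.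
have -> : proj_i Jt *m complexify a =
    complexify a + 'i%C *: complexify (- (Jt *m a)).
  by rewrite /proj_i mulmxBl mul1mx -scalemxAl complexifyN complexifyM scalerN.
rewrite !mulmxDr -!scalemxAr -complexify_tr -!complexifyM.
rewrite -!add_col_mx -!scale_col_mx -!complexify_col_mx.
move=> /complexify_inj[Ea _].
rewrite /i_eigenspace /= mulmxDr -scalemxAr -!complexifyM scalerDr ii_scale addrC.
rewrite [RHS]addrC -complexifyN addrC => /complexify_inj[EJ _].
move: Ea; rewrite /a => /eq_col_mx[-> ->].
by exists e1, (- X2), (- e2); split=> //; rewrite EJ opp_col_mx mulmxN.
Qed.

End Induced.

(** * The induced structure computed from a frame of im F + im pi *)

Section Frame.
Variables (n p k : nat) (F : 'M[R]_(n, p)) (J : 'M[R]_(n + n)).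
Variable (S : 'M[R]_(n, k)).

(** Matrix of the linear system [F^T S c = xi], [S^T (F Y - pi S c) = S^T A F X] in the unknown
    [(Y, c)]. The second equation is the tangent part of [J (F X, S c) = (F Y, zeta)]; multiplying
    it by [S^T] makes the system square. *)
Definition frame_mx : 'M[R]_(p + k) :=
  block_mx 0 (F^T *m S) (S^T *m F) (- (S^T *m sharp_pi J *m S)).

Definition frame_solution : 'M[R]_(p + k, p + p) :=
  invmx frame_mx *m block_mx 0 1%:M (S^T *m ulsubmx J *m F) 0.

(** Sends [(X, xi)] to [(F X, S c)], where [(Y, c)] solves the system. *)
Definition frame_lift : 'M[R]_(n + n, p + p) :=
  col_mx (row_mx F 0) (S *m dsubmx frame_solution).

(** Sends [(X, xi)] to [(Y, F^T zeta)], with [zeta] the covector part of [J (F X, S c)]. *)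
Definition frame_induced : 'M[R]_(p + p) :=
  col_mx (usubmx frame_solution) (F^T *m dsubmx (J *m frame_lift)).

Variable (Jt : 'M[R]_(p + p)).
Hypotheses (gJ : linear_gcs J) (iJ : induced_structure F J Jt).
Hypothesis Sinj : injective (fun c : 'cV[R]_k => S *m c).
Hypothesis Srange :
  [set w | exists (v : 'cV[R]_p) (alpha : 'cV[R]_n),
             w = F *m v + sharp_pi J *m alpha] = range (fun c : 'cV[R]_k => S *m c).

(** The equality of ranges is used through three factorisations: of [F] and of [pi] through [S], and
    of [S] through the two together. *)
Let factorF : exists P, F = S *m P.
Proof.
apply: factor_range => v.
have : range (fun c : 'cV[R]_k => S *m c) (F *m v).
  by rewrite -Srange; exists v, 0; rewrite mulmx0 addr0.
by move=> [c _ <-]; exists c.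
Qed.

Let factorpi : exists Q, sharp_pi J = S *m Q.
Proof.
apply: factor_range => v.
have : range (fun c : 'cV[R]_k => S *m c) (sharp_pi J *m v).
  by rewrite -Srange; exists 0, v; rewrite mulmx0 add0r.
by move=> [c _ <-]; exists c.
Qed.

Let factorS : exists PQ, S = row_mx F (sharp_pi J) *m PQ.
Proof.
apply: factor_range => c.
have : range (fun c : 'cV[R]_k => S *m c) (S *m c) by exists c.
rewrite -Srange => -[v [alpha ->]]; exists (col_mx v alpha).
by rewrite mul_row_col.
Qed.

(** The Gram matrix of independent real columns: [S^T S u = 0] makes the sum of squares of the
    entries of [S u] vanish. *)
Let SS_unit : S^T *m S \in unitmx.
Proof.
apply: unitmx_injective => u SSu.
have /eqP : ((S *m u)^T *m (S *m u)) 0 0 = 0.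
  by rewrite trmx_mul -mulmxA [S^T *m _]mulmxA SSu mulmx0 mxE.
rewrite mxE psumr_eq0 => [|i _]; last by rewrite mxE -expr2 sqr_ge0.
move=> /allP Su; apply: Sinj; rewrite mulmx0; apply/colP => i.
have := Su i; rewrite mem_index_enum => /(_ isT).
by rewrite /= mxE -expr2 sqrf_eq0 => /eqP ->; rewrite mxE.
Qed.

Let SSI (u : 'cV[R]_k) : S^T *m (S *m u) = 0 -> u = 0.
Proof.
rewrite mulmxA => /(congr1 (mulmx (invmx (S^T *m S)))).
by rewrite mulKmx// mulmx0.
Qed.

(* If [F^T S c = 0] and [pi S c = F Y], then [Jt] maps [0] to a vector with
   tangent part [Y], so [Y = 0] and [S c], which lies in the range of [S], is
   orthogonal to it. *)
Lemma frame_mx_unit : frame_mx \in unitmx.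
Proof.
have [P FP] := factorF; have [Q piQ] := factorpi; have [PQ SPQ] := factorS.
apply: unitmx_injective => u Mu.
pose Y := usubmx u; pose c := dsubmx u.
have : frame_mx *m col_mx Y c = col_mx 0 0 by rewrite vsubmxK Mu col_mx0.
rewrite /frame_mx mul_block_col mul0mx add0r => /eq_col_mx[FSc].
rewrite mulNmx -!mulmxA -mulmxBr => H2.
have FYE : F *m Y = sharp_pi J *m (S *m c).
  apply/eqP; rewrite -subr_eq0; apply/eqP; move: H2.
  rewrite piQ FP -!mulmxA -mulmxBr => /SSI ->.
  by rewrite mulmx0.
have Y0 : Y = 0.
  have := @induced_equivariant _ _ _ _ _ gJ iJ 0 Y (S *m c) (drsubmx J *m (S *m c)).
  rewrite mulmx0 -{1}(submxK J) mul_block_col !mulmx0 !add0r FYE mulmxA -/(sharp_pi J).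
  move=> /(_ erefl); rewrite mulmxA FSc col_mx0 mulmx0 -col_mx0.
  by move=> /eq_col_mx[].
have c0 : c = 0.
  apply: SSI; rewrite {1}SPQ trmx_mul tr_row_mx -mulmxA mul_col_mx.
  rewrite [F^T *m _]mulmxA FSc (sharp_pi_skew gJ) mulNmx -FYE Y0 mulmx0 oppr0.
  by rewrite col_mx0 mulmx0.
by rewrite -(vsubmxK u) -/Y -/c Y0 c0 col_mx0.
Qed.

(** The lift [eta] from [induced_lift_ex] is replaced by its Euclidean orthogonal projection [S c]
    onto the range of [S]. The difference is killed by [S^T], hence by [F^T] and, as [pi] is skew,
    also by [pi]; so both equations survive. *)
Lemma frame_solutionP (X xi : 'cV[R]_p) : exists (Y : 'cV[R]_p) (c : 'cV[R]_k),
  [/\ frame_solution *m col_mx X xi = col_mx Y c, F^T *m (S *m c) = xi &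
      usubmx (J *m col_mx (F *m X) (S *m c)) = F *m Y].
Proof.
have [P FP] := factorF; have [Q piQ] := factorpi.
have [eta [Y [zeta [etaE JE]]]] := induced_lift_ex iJ X xi.
pose c := invmx (S^T *m S) *m (S^T *m eta).
have Sk : S^T *m (eta - S *m c) = 0.
  by rewrite mulmxBr mulmxA /c mulKVmx// subrr.
have Fk : F^T *m (S *m c) = xi.
  apply/eqP; rewrite eq_sym -subr_eq0 -etaE -mulmxBr FP trmx_mul -mulmxA.
  by rewrite Sk mulmx0.
have pik : sharp_pi J *m (S *m c) = sharp_pi J *m eta.
  apply/eqP; rewrite eq_sym -subr_eq0 -mulmxBr -oppr_eq0 -mulNmx.
  by rewrite -(sharp_pi_skew gJ) piQ trmx_mul -mulmxA Sk mulmx0.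
have uJ (e : 'cV[R]_n) : usubmx (J *m col_mx (F *m X) e) =
    ulsubmx J *m (F *m X) + sharp_pi J *m e.
  by rewrite -{1}(submxK J) mul_block_col col_mxKu.
have JE' : ulsubmx J *m (F *m X) + sharp_pi J *m eta = F *m Y.
  by rewrite -uJ JE col_mxKu.
exists Y, c; split=> //; last by rewrite uJ pik.
have E : block_mx 0 1%:M (S^T *m ulsubmx J *m F) 0 *m col_mx X xi =
    frame_mx *m col_mx Y c.
  rewrite /frame_mx !mul_block_col !mul0mx !add0r mul1mx addr0 -(mulmxA F^T) Fk.
  by congr col_mx; rewrite mulNmx -!mulmxA -mulmxBr -JE' pik addrK.
by rewrite /frame_solution -(mulmxA (invmx _)) E mulKmx ?frame_mx_unit.
Qed.

Lemma frame_liftP (w : 'cV[R]_(p + p)) :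
  [/\ usubmx (frame_lift *m w) = F *m usubmx w,
      F^T *m dsubmx (frame_lift *m w) = dsubmx w,
      usubmx (J *m (frame_lift *m w)) = F *m usubmx (Jt *m w),
      F^T *m dsubmx (J *m (frame_lift *m w)) = dsubmx (Jt *m w) &
      usubmx (frame_solution *m w) = usubmx (Jt *m w)].
Proof.
rewrite -(vsubmxK w); set X := usubmx w; set xi := dsubmx w.
have [Y [c [E Fc JE]]] := frame_solutionP X xi.
have LE : frame_lift *m col_mx X xi = col_mx (F *m X) (S *m c).
  rewrite /frame_lift mul_col_mx mul_row_col mul0mx addr0 -mulmxA.
  by rewrite mul_dsub_mx E col_mxKd.
have JtE : Jt *m col_mx X xi =
    col_mx Y (F^T *m dsubmx (J *m col_mx (F *m X) (S *m c))).
  by rewrite -Fc; apply: (induced_equivariant gJ iJ); rewrite -JE vsubmxK.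
by rewrite LE JtE E !col_mxKu !col_mxKd.
Qed.

Lemma frame_inducedE : Jt = frame_induced.
Proof.
apply: mulmx_cV_ext => w; rewrite /frame_induced mul_col_mx.
have [_ _ _ E2 E1] := frame_liftP w.
by rewrite mul_usub_mx E1 -mulmxA mul_dsub_mx -mulmxA E2 vsubmxK.
Qed.

(** The lift of [w] pulls back to [w], and its image under [J] to [Jt w = i w]. Hence half of
    [1 - i J] applied to the lift pulls back to [(w + w) / 2 = w], and it lies in L by
    construction. *)
Lemma eigen_lift (w : 'cV[R[i]]_(p + p)) : i_eigenspace Jt w ->
  let u := proj_i J *m (2^-1 *: (complexify frame_lift *m w)) in
  [/\ i_eigenspace J u, usubmx u = complexify F *m usubmx w &
      (complexify F)^T *m dsubmx u = dsubmx w].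
Proof.
move=> Jw u; set L := complexify frame_lift *m w.
(* [frame_liftP] speaks of real vectors; as matrix identities its equations can be complexified. *)
have [E1 E2 E3 E4] : [/\ usubmx frame_lift = F *m usubmx 1%:M,
    F^T *m dsubmx frame_lift = dsubmx 1%:M,
    usubmx (J *m frame_lift) = F *m usubmx Jt &
    F^T *m dsubmx (J *m frame_lift) = dsubmx Jt].
  split; apply: mulmx_cV_ext => v; have [H1 H2 H3 H4 _] := frame_liftP v.
  - by rewrite mul_usub_mx -mulmxA mul_usub_mx mul1mx.
  - by rewrite -mulmxA !mul_dsub_mx mul1mx.
  - by rewrite mul_usub_mx -(mulmxA F) mul_usub_mx -(mulmxA J).
  - by rewrite -(mulmxA F^T) !mul_dsub_mx -(mulmxA J).
have uL : usubmx L = complexify F *m usubmx w.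
  rewrite -mul_usub_mx -complexify_usubmx E1 complexifyM -mulmxA.
  by rewrite complexify_usubmx mul_usub_mx complexify1 mul1mx.
have dL : (complexify F)^T *m dsubmx L = dsubmx w.
  rewrite -mul_dsub_mx -complexify_dsubmx -complexify_tr mulmxA -complexifyM E2.
  by rewrite complexify_dsubmx mul_dsub_mx complexify1 mul1mx.
have uJL : usubmx (complexify J *m L) = 'i%C *: (complexify F *m usubmx w).
  rewrite mulmxA -complexifyM -mul_usub_mx -complexify_usubmx E3 complexifyM.
  by rewrite -mulmxA complexify_usubmx mul_usub_mx Jw linearZ /= -scalemxAr.
have dJL : (complexify F)^T *m dsubmx (complexify J *m L) = 'i%C *: dsubmx w.
  rewrite mulmxA -complexifyM -mul_dsub_mx -complexify_dsubmx -complexify_tr.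
  rewrite mulmxA -complexifyM E4.
  by rewrite complexify_dsubmx mul_dsub_mx Jw linearZ.
have half m (x : 'cV[R[i]]_m) : 2^-1 *: (x + x) = x.
  have -> : x + x = 2 *: x by rewrite scaler_nat mulr2n.
  by rewrite scalerA mulVf ?scale1r// pnatr_eq0.
have uE : u = 2^-1 *: (L - 'i%C *: (complexify J *m L)).
  by rewrite /u /proj_i -scalemxAr mulmxBl mul1mx -scalemxAl.
split; first exact: proj_i_eigen.
- by rewrite uE linearZ /= raddfB /= linearZ /= uL uJL ii_scale opprK half.
- rewrite uE linearZ /= -scalemxAr raddfB /= mulmxBr dL linearZ /= -scalemxAr dJL.
  by rewrite ii_scale opprK half.
Qed.

End Frame.
End ComplexMatrices.

(** * The Courant bracket *)

Section Bracket.
Variable R : realType.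

Lemma dirCB q m k (A B : 'cV[R]_q -> 'M[R[i]]_(m, k)) y X :
  mx_cdiff A y -> mx_cdiff B y ->
  dirC (fun z => A z - B z) y X = dirC A y X - dirC B y X.
Proof.
move=> dA dB.
have -> : (fun z => A z - B z) = (fun z => A z + (- 1%:M) *m B z).
  by apply/funext => z; rewrite mulNmx mul1mx.
have dN : mx_cdiff (fun=> - 1%:M : 'M[R[i]]_m) y by exact: mx_cdiff_cst.
rewrite dirCD//; last exact: mx_cdiffM.
by rewrite dirCM// dirC_cst mul0mx add0r mulNmx mul1mx.
Qed.

Lemma dirC_usubmx q m1 m2 k (A : 'cV[R]_q -> 'M[R[i]]_(m1 + m2, k)) y X :
  dirC (fun z => usubmx (A z)) y X = usubmx (dirC A y X).
Proof.
by rewrite usubmxEsub -dirC_mxsub; congr (dirC _ y X).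
Qed.

Lemma dirC_dsubmx q m1 m2 k (A : 'cV[R]_q -> 'M[R[i]]_(m1 + m2, k)) y X :
  dirC (fun z => dsubmx (A z)) y X = dsubmx (dirC A y X).
Proof.
by rewrite dsubmxEsub -dirC_mxsub; congr (dirC _ y X).
Qed.

Lemma mx_cdiff_usubmx q m1 m2 k (A : 'cV[R]_q -> 'M[R[i]]_(m1 + m2, k)) y :
  mx_cdiff A y -> mx_cdiff (fun z => usubmx (A z)) y.
Proof.
by move=> dA; under eq_fun do rewrite usubmxEsub; exact: mx_cdiff_mxsub.
Qed.

Lemma mx_cdiff_dsubmx q m1 m2 k (A : 'cV[R]_q -> 'M[R[i]]_(m1 + m2, k)) y :
  mx_cdiff A y -> mx_cdiff (fun z => dsubmx (A z)) y.
Proof.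
by move=> dA; under eq_fun do rewrite dsubmxEsub; exact: mx_cdiff_mxsub.
Qed.

(** The expression for [<[s, t], w>], with the derivatives [Ds], [Dt] and the directions as free
    arguments. The directions may live on a space of another dimension than the values, as for
    sections along a submanifold. *)
Definition bracket_form (q n : nat) (Ds Dt : 'cV[R[i]]_q -> 'cV[R[i]]_(n + n))
    (X Y Z : 'cV[R[i]]_q) (s t w : 'cV[R[i]]_(n + n)) : 'M[R[i]]_1 :=
  pairing (Dt X) w - pairing (Ds Y) w
  + 2^-1 *: (pairing (Ds Z) t - pairing s (Dt Z)).

Lemma lie_derivative_pairing q (X mu : 'cV[R]_q -> 'cV[R[i]]_q) y (Z : 'cV[R[i]]_q) :
  (lie_derivative X mu y)^T *m Z =
    (dirC mu y (X y))^T *m Z + (mu y)^T *m dirC X y Z.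
Proof.
rewrite /lie_derivative -!jacC_dirC.
move: (jacC mu y *m X y) (jacC X y) (mu y) => A B D.
by rewrite raddfD /= mulmxDl trmx_mul trmxK mulmxA.
Qed.

Lemma differential_pairing q (h : 'cV[R]_q -> 'cV[R[i]]_1) y (Z : 'cV[R[i]]_q) :
  (differential h y)^T *m Z = dirC h y Z.
Proof. by rewrite /differential trmxK jacC_dirC. Qed.

Lemma courant_algebra (K : numFieldType) (a1 a2 a3 a4 a5 a6 a7 a8 : 'M[K]_1) :
  a1 + a2 - (a3 + a4) + 2^-1 *: (a5 + a4 - (a6 + a2)) + (a7 - a8) =
  a1 + a7 - (a3 + a8) + 2^-1 *: (a5 + a2 - (a4 + a6)).
Proof. by apply/matrixP => i j; rewrite !mxE; field. Qed.

(** Pairing with [w] turns the exterior derivative into a derivative along the tangent part of [w];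
    by the Leibniz rule half of its terms combine with those of the Lie derivatives. *)
Lemma courant_pairing (q : nat) (s t : 'cV[R]_q -> 'cV[R[i]]_(q + q)) y
    (w : 'cV[R[i]]_(q + q)) : mx_cdiff s y -> mx_cdiff t y ->
  pairing (courant_bracket s t y) w =
    bracket_form (dirC s y) (dirC t y) (usubmx (s y)) (usubmx (t y)) (usubmx w)
      (s y) (t y) w.
Proof.
move=> ds dt.
have dus := mx_cdiff_usubmx ds; have dds := mx_cdiff_dsubmx ds.
have dut := mx_cdiff_usubmx dt; have ddt := mx_cdiff_dsubmx dt.
have dst := mx_cdiffM (mx_cdiff_tr dds) dut.
have dts := mx_cdiffM (mx_cdiff_tr ddt) dus.
rewrite /bracket_form !pairingE /courant_bracket col_mxKu col_mxKd.
have trE (A B D Z : 'cV[R[i]]_q) : (A - B + 2^-1 *: D)^T *m Z =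
    A^T *m Z - B^T *m Z + 2^-1 *: (D^T *m Z).
  by rewrite raddfD /= raddfB /= linearZ /= mulmxDl mulmxBl -scalemxAl.
rewrite trE !lie_derivative_pairing differential_pairing /lie_bracket mulmxBr !jacC_dirC.
rewrite dirCB// (dirCM _ (mx_cdiff_tr dds) dut) (dirCM _ (mx_cdiff_tr ddt) dus).
rewrite !dirC_tr !dirC_usubmx !dirC_dsubmx.
move: (dirC s y) (dirC t y) (s y) (t y) => Ds Dt a b.
exact: courant_algebra.
Qed.

Lemma dirC_comp_mul (p n : nat) (E : 'cV[R]_n -> 'M[R[i]]_(n + n))
    (f : 'cV[R]_p -> 'cV[R]_n) (c : 'cV[R]_p -> 'cV[R[i]]_(n + n)) y X :
  mx_cdiff E (f y) -> (forall k, differentiable (fun z => f z k 0) y) ->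
  mx_cdiff c y ->
  dirC (fun z => E (f z) *m c z) y X =
    dirC E (f y) (complexify (jac f y) *m X) *m c y + E (f y) *m dirC c y X.
Proof.
move=> dE df dc; apply: etrans (dirCM X (mx_cdiff_comp dE df) dc) _.
by rewrite -(dirC_comp X dE df).
Qed.

(** Terms in the image of [E] drop out because that image is orthogonal to [s], [t] and [w]. The map
    [G] carries directions in the source to directions in the target. *)
Lemma bracket_form_shift (p q n : nat) (Ds Dt : 'cV[R[i]]_p -> 'cV[R[i]]_(n + n))
    (Ds' Dt' : 'cV[R[i]]_q -> 'cV[R[i]]_(n + n)) (es et : 'cV[R[i]]_p -> 'cV[R[i]]_(n + n))
    (E : 'M[R[i]]_(n + n)) (G : 'cV[R[i]]_p -> 'cV[R[i]]_q) X Y Z s t w :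
  (forall V, Ds V = Ds' (G V) + E *m es V) ->
  (forall V, Dt V = Dt' (G V) + E *m et V) ->
  (forall u, pairing (E *m u) w = 0) -> (forall u, pairing (E *m u) t = 0) ->
  (forall u, pairing s (E *m u) = 0) ->
  bracket_form Ds Dt X Y Z s t w = bracket_form Ds' Dt' (G X) (G Y) (G Z) s t w.
Proof.
move=> DsE DtE Ew Et sE; rewrite /bracket_form !DsE !DtE !pairingDl pairingDr.
by rewrite (Ew (et X)) (Ew (es Y)) (Et (es Z)) (sE (et Z)) !addr0.
Qed.

(* The derivatives of the coefficients [a] and [b] drop out because the
   image of [E] is isotropic. *)
Lemma bracket_form_tensor (p n : nat) (E : 'cV[R]_n -> 'M[R[i]]_(n + n))
    (f : 'cV[R]_p -> 'cV[R]_n) (a b : 'cV[R]_p -> 'cV[R[i]]_(n + n)) y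
    (X Y Z : 'cV[R[i]]_p) (w : 'cV[R[i]]_(n + n)) :
  mx_cdiff E (f y) -> (forall k, differentiable (fun z => f z k 0) y) ->
  mx_cdiff a y -> mx_cdiff b y ->
  (forall u v, pairing (E (f y) *m u) (E (f y) *m v) = 0) ->
  (forall u, pairing (E (f y) *m u) w = 0) ->
  let F := complexify (jac f y) in
  bracket_form (dirC (fun z => E (f z) *m a z) y) (dirC (fun z => E (f z) *m b z) y)
    X Y Z (E (f y) *m a y) (E (f y) *m b y) w =
  bracket_form (fun V => dirC E (f y) V *m a y) (fun V => dirC E (f y) V *m b y)
    (F *m X) (F *m Y) (F *m Z) (E (f y) *m a y) (E (f y) *m b y) w.
Proof.
move=> dE df da db EE Ew F.
apply: (@bracket_form_shift _ _ _ _ _ (fun V => dirC E (f y) V *m a y)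
  (fun V => dirC E (f y) V *m b y) (dirC a y) (dirC b y) (E (f y)) (mulmx F)) => // V.
- exact: dirC_comp_mul.
- exact: dirC_comp_mul.
Qed.

(** Schwarz's theorem, extended bilinearly to complex directions. *)
Lemma second_derivative_sym (p n : nat) (f : 'cV[R]_p -> 'cV[R]_n) (U : set 'cV[R]_p)
    y (X Z : 'cV[R[i]]_p) : open U -> U y -> smooth_on U f ->
  dirC (fun z => complexify (jac f z)) y X *m Z =
  dirC (fun z => complexify (jac f z)) y Z *m X.
Proof.
move=> oU Uy sf; apply/matrixP => i j; rewrite !ord1 !mxE.
have cE (l k : 'I_p) : cpartial l (fun z => complexify (jac f z) i k) y =
    (partial l (partial k (fun z => f z i 0)) y)%:C.
  have RE : (fun z => complex.Re (complexify (jac f z) i k)) = partial k (fun z => f z i 0).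
    by apply/funext => z; rewrite !mxE.
  have IE : (fun z => complex.Im (complexify (jac f z) i k)) = (fun=> 0).
    by apply/funext => z; rewrite !mxE.
  by rewrite /cpartial RE IE; congr Complex; exact: derive_cst.
under eq_bigr do rewrite dirCE mulr_suml.
under [RHS]eq_bigr do rewrite dirCE mulr_suml.
rewrite exchange_big /=; apply: eq_bigr => k _; apply: eq_bigr => l _.
have gen (a b c d : R[i]) : a = b -> a * c * d = b * d * c.
  by move=> ->; rewrite mulrAC.
apply: (gen _ _ (X k 0) (Z l 0) (etrans (cE k l) (etrans _ (esym (cE l k))))).
exact: (congr1 (fun a => a%:C) (Schwarz _ _ oU (sf 2%N i 0) Uy)).
Qed.

Lemma lift_algebra (V : zmodType) (a b c d : V) : a + b + c = b + (d + c) + a - d.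
Proof.
by apply/esym/eqP; rewrite subr_eq [_ + a]addrC (addrC d) !addrA.
Qed.

Lemma pullback_algebra (K : numFieldType) (a1 a2 a3 a4 b1 b2 b3 : 'M[K]_1) :
  a1 + b1 - b3 - (a2 + b2 - b3) + 2^-1 *: (a3 + b2 - b1 - (a4 + b1 - b2)) =
  a1 - a2 + 2^-1 *: (a3 - a4).
Proof. by apply/matrixP => i j; rewrite !mxE; field. Qed.

(** * The bracket form under pullback *)

Section Pullback.
Variables (p n : nat) (f : 'cV[R]_p -> 'cV[R]_n) (U : set 'cV[R]_p) (y : 'cV[R]_p).
Hypotheses (oU : open U) (Uy : U y) (sf : smooth_on U f).

Let F z := complexify (jac f z).

(** The relation is imposed near [y] so that it can be differentiated there. *)
Definition lifts (s : 'cV[R]_p -> 'cV[R[i]]_(p + p))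
    (s' : 'cV[R]_p -> 'cV[R[i]]_(n + n)) :=
  \near y, usubmx (s' y) = F y *m usubmx (s y) /\
           dsubmx (s y) = (F y)^T *m dsubmx (s' y).

Let dF : mx_cdiff F y.
Proof.
apply: (smoothC_cdiff oU Uy); apply: smoothC_complexify => //.
exact: smooth_on_jac.
Qed.

(** Differentiating the relations between [t] and [t'] by the Leibniz rule produces, besides the
    expected pairing, two terms in the second derivatives of [f]. *)
Lemma pairing_lift t t' w w' V : mx_cdiff t y -> mx_cdiff t' y -> lifts t t' ->
  usubmx w' = F y *m usubmx w -> dsubmx w = (F y)^T *m dsubmx w' ->
  pairing (dirC t y V) w = pairing (dirC t' y V) w'
    + (dsubmx (t' y))^T *m (dirC F y V *m usubmx w)
    - (dsubmx w')^T *m (dirC F y V *m usubmx (t y)).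
Proof.
move=> dt dt' tt' uw dw.
have dut := mx_cdiff_usubmx dt; have ddt' := mx_cdiff_dsubmx dt'.
have uE : usubmx (dirC t' y V) = dirC F y V *m usubmx (t y) + F y *m usubmx (dirC t y V).
  rewrite -dirC_usubmx (_ : dirC _ y V = dirC (fun z => F z *m usubmx (t z)) y V).
    by rewrite dirCM// dirC_usubmx.
  by apply: dirC_eq; apply: filterS tt' => z [].
have dE : dsubmx (dirC t y V) =
    (dirC F y V)^T *m dsubmx (t' y) + (F y)^T *m dsubmx (dirC t' y V).
  rewrite -dirC_dsubmx (_ : dirC _ y V = dirC (fun z => (F z)^T *m dsubmx (t' z)) y V).
    by rewrite dirCM// ?dirC_tr ?dirC_dsubmx//; exact: mx_cdiff_tr.
  by apply: dirC_eq; apply: filterS tt' => z [].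
rewrite !pairingE uE dE dw uw raddfD /= !trmx_mul !trmxK !mulmxDl !mulmxDr !mulmxA.
exact: lift_algebra.
Qed.

(** The two sides differ by second derivatives of [f] paired with the covector parts of [s'], [t']
    and [w']. Symmetry reduces these to three quantities, whose coefficients add up to zero. *)
Lemma bracket_form_pullback s t s' t' w w' :
  mx_cdiff s y -> mx_cdiff s' y -> lifts s s' ->
  mx_cdiff t y -> mx_cdiff t' y -> lifts t t' ->
  usubmx w' = F y *m usubmx w -> dsubmx w = (F y)^T *m dsubmx w' ->
  bracket_form (dirC s y) (dirC t y) (usubmx (s y)) (usubmx (t y)) (usubmx w)
    (s y) (t y) w =
  bracket_form (dirC s' y) (dirC t' y) (usubmx (s y)) (usubmx (t y)) (usubmx w)
    (s' y) (t' y) w'.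
Proof.
move=> ds ds' ss' dt dt' tt' uw dw.
have [us ds0] := nbhs_singleton ss'; have [ut dt0] := nbhs_singleton tt'.
rewrite /bracket_form (pairingC (s y)) (pairingC (s' y)).
rewrite (pairing_lift _ dt dt' tt' uw dw) (pairing_lift _ ds ds' ss' uw dw).
rewrite (pairing_lift _ dt dt' tt' us ds0) (pairing_lift _ ds ds' ss' ut dt0).
rewrite !(second_derivative_sym _ (usubmx w) oU Uy sf).
rewrite (second_derivative_sym (usubmx (t y)) (usubmx (s y)) oU Uy sf).
exact: pullback_algebra.
Qed.

End Pullback.

Lemma jac_id (n : nat) (y : 'cV[R]_n) : jac (fun z : 'cV[R]_n => z) y = 1%:M.
Proof. by apply/matrixP => i j; rewrite !mxE partial_coord. Qed.

End Bracket.

(** * Sections over a manifold *)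

Section SmoothComplex.
Variables (R : realType) (q : nat) (U : set 'cV[R]_q).
Hypothesis oU : open U.

Lemma smoothC_on_eq m k (A B : 'cV[R]_q -> 'M[R[i]]_(m, k)) :
  (forall y, U y -> A y = B y) -> smoothC_on U A -> smoothC_on U B.
Proof.
move=> AB [sR sI]; split.
- by apply: (smooth_on_eq oU _ sR) => y /AB ->.
- by apply: (smooth_on_eq oU _ sI) => y /AB ->.
Qed.

Lemma smoothC_onM m k r (A : 'cV[R]_q -> 'M[R[i]]_(m, k))
    (B : 'cV[R]_q -> 'M[R[i]]_(k, r)) :
  smoothC_on U A -> smoothC_on U B -> smoothC_on U (fun y => A y *m B y).
Proof.
move=> [sA iA] [sB iB]; split.
- apply: (smooth_on_eq oU _ (smooth_onB oU (smooth_onM oU sA sB) (smooth_onM oU iA iB))).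
  move=> y _; apply/matrixP => i j; rewrite !mxE Re_sum -sumrB.
  by apply: eq_bigr => l _; rewrite Re_mul !mxE.
- apply: (smooth_on_eq oU _ (smooth_onD oU (smooth_onM oU sA iB) (smooth_onM oU iA sB))).
  move=> y _; apply/matrixP => i j; rewrite !mxE Im_sum -big_split.
  by apply: eq_bigr => l _; rewrite Im_mul !mxE.
Qed.

Lemma smoothC_onZ_real m k (a : 'cV[R]_q -> R) (B : 'M[R[i]]_(m, k)) :
  (forall r, C_on r U a) -> smoothC_on U (fun y => (a y)%:C *: B).
Proof.
move=> sa; split.
- apply: (@smooth_on_eq _ _ _ oU _ _ (fun y => a y *: Defs.ReM B)).
    by move=> y _; apply/matrixP => i j; rewrite !mxE Re_mul mul0r subr0.
  by apply: smooth_onZ => //; exact: smooth_on_cst.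
- apply: (@smooth_on_eq _ _ _ oU _ _ (fun y => a y *: Defs.ImM B)).
    by move=> y _; apply/matrixP => i j; rewrite !mxE Im_mul mul0r addr0.
  by apply: smooth_onZ => //; exact: smooth_on_cst.
Qed.

Lemma smoothC_on_proj_i n (J : 'cV[R]_q -> 'M[R]_(n + n)) :
  smooth_on U J -> smoothC_on U (fun y => proj_i (J y)).
Proof.
move=> sJ; split.
- apply: (@smooth_on_eq _ _ _ oU _ _ (fun=> 1%:M)); last exact: smooth_on_cst.
  move=> y _; apply/matrixP => i j; rewrite !mxE Re_add.
  by case: (i == j) => /=; lra.
- apply: (@smooth_on_eq _ _ _ oU _ _ (fun y => - J y)); last exact: smooth_onN.
  move=> y _; apply/matrixP => i j; rewrite !mxE Im_add.
  by case: (i == j) => /=; lra.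
Qed.

End SmoothComplex.

Lemma smoothC_on_local (R : realType) q m k (U : set 'cV[R]_q)
    (A : 'cV[R]_q -> 'M[R[i]]_(m, k)) :
  (forall y, U y -> exists2 V, V y & smoothC_on V A) -> smoothC_on U A.
Proof.
move=> H; split; apply: smooth_on_local => y /H[V Vy [sR sI]]; by exists V.
Qed.

Lemma jac_comp (R : realType) (p n m : nat) (g : 'cV[R]_n -> 'cV[R]_m)
    (f : 'cV[R]_p -> 'cV[R]_n) y :
  (forall i, differentiable (fun z => g z i 0) (f y)) ->
  (forall k, differentiable (fun z => f z k 0) y) ->
  jac (fun z => g (f z)) y = jac g (f y) *m jac f y.
Proof.
move=> dg df; apply/matrixP => i j; rewrite [RHS]mxE [LHS]mxE.
apply: etrans (partial_comp j (dg i) df) _.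
by apply: eq_bigr => k _; rewrite !mxE.
Qed.

Lemma jac_eq (R : realType) (p n : nat) (f g : 'cV[R]_p -> 'cV[R]_n) y :
  (\near y, f y = g y) -> jac f y = jac g y.
Proof.
move=> fg; apply/matrixP => i j; rewrite !mxE.
by apply: near_eq_derive; apply: filterS fg => z ->.
Qed.

(** * Coordinate changes and their Jacobians *)

Section Charts.
Variables (R : realType) (n : nat) (M : manifold R n).
Implicit Types (a b c : atlas M) (x : M) (U : set M).

Lemma chart_imgK a U y : chart_img a U y ->
  [/\ chart_dom a (chart_inv a y), U (chart_inv a y) &
      chart_map a (chart_inv a y) = y].
Proof. by move=> [x [ax Ux] <-]; rewrite chart_mapK. Qed.

Lemma chart_img_map a U x : chart_dom a x -> U x -> chart_img a U (chart_map a x).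
Proof. by move=> ax Ux; exists x. Qed.

Lemma open_chart_img a U : open U -> open (chart_img a U).
Proof.
move=> oU; rewrite openE => _ [x [ax Ux] <-].
have ix : (chart_map a @` chart_dom a) (chart_map a x) by exists x.
have n1 : \forall z \near chart_map a x, (chart_map a @` chart_dom a) z.
  by apply: open_nbhs_nbhs; split=> //; exact: chart_img_open.
have n2 : \forall z \near chart_map a x, U (chart_inv a z).
  apply: (chart_inv_cont ix); rewrite chart_mapK//.
  by apply: open_nbhs_nbhs.
rewrite /interior /=; apply: filterS2 n1 n2 => z [x' ax' <-].
by rewrite chart_mapK// => Ux'; exists x'.
Qed.

Definition transition a b (y : 'cV[R]_n) : 'cV[R]_n := chart_map b (chart_inv a y).

Lemma smooth_transition a b : smooth_on (chart_img a (chart_dom b)) (transition a b).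
Proof. exact: chart_transition. Qed.

Lemma open_chart_dom_img a b : open (chart_img a (chart_dom b)).
Proof. by apply: open_chart_img; exact: chart_dom_open. Qed.

Lemma transition_differentiable a b x i : chart_dom a x -> chart_dom b x ->
  differentiable (fun z => transition a b z i 0) (chart_map a x).
Proof.
move=> ax bx; have ix := chart_img_map ax bx.
exact: (smooth_on_differentiable (@open_chart_dom_img a b) _ _ (@smooth_transition a b) ix).
Qed.

Lemma tjac_comp a b c x : chart_dom a x -> chart_dom b x -> chart_dom c x ->
  tjac b c x *m tjac a b x = tjac a c x.
Proof.
move=> ax bx cx; have tx : transition a b (chart_map a x) = chart_map b x.
  by rewrite /transition chart_mapK.
rewrite /tjac -{1}tx -jac_comp.
- apply: jac_eq; have ix := chart_img_map ax bx.
  apply: filterS (open_nbhs_nbhs (conj (@open_chart_dom_img a b) ix)) => z.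
  by move=> /chart_imgK[_ bz _]; rewrite /transition chart_mapK.
- by move=> i; rewrite tx; exact: transition_differentiable.
- by move=> i; exact: transition_differentiable.
Qed.

Lemma tjac_id a x : chart_dom a x -> tjac a a x = 1%:M.
Proof.
move=> ax; rewrite /tjac -(jac_id (chart_map a x)); apply: jac_eq.
have ix := chart_img_map ax ax.
apply: filterS (open_nbhs_nbhs (conj (@open_chart_dom_img a a) ix)) => z.
by move=> /chart_imgK[].
Qed.

Lemma big_tjac_comp a b c x : chart_dom a x -> chart_dom b x -> chart_dom c x ->
  big_tjac b c x *m big_tjac a b x = big_tjac a c x.
Proof.
move=> ax bx cx; rewrite /big_tjac mulmx_block !mulmx0 !mul0mx !addr0 !add0r.
by rewrite -trmx_mul !tjac_comp.
Qed.

Lemma big_tjac_id a x : chart_dom a x -> big_tjac a a x = 1%:M.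
Proof. by move=> ax; rewrite /big_tjac tjac_id// trmx1 -scalar_mx_block. Qed.

Lemma smooth_tjac a b :
  smooth_on (chart_img a (chart_dom b)) (fun y => tjac a b (chart_inv a y)).
Proof.
have oV := @open_chart_dom_img a b.
apply: (smooth_on_eq oV _ (smooth_on_jac (@smooth_transition a b))) => y.
by move=> /chart_imgK[_ _ yE]; rewrite /tjac yE.
Qed.

Lemma transition_img a b y : chart_img a (chart_dom b) y ->
  chart_img b (chart_dom a) (transition a b y).
Proof. by move=> /chart_imgK[ay bya _]; exact: chart_img_map. Qed.

(** The Jacobian from [b] to [a] is smooth in the coordinates of [b]; composing with the transition
    map expresses it in those of [a]. *)
Lemma smooth_tjac_swap a b :
  smooth_on (chart_img a (chart_dom b)) (fun y => tjac b a (chart_inv a y)).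
Proof.
have oV := @open_chart_dom_img a b; have oW := @open_chart_dom_img b a.
have := smooth_on_comp oV oW (@transition_img a b) (@smooth_tjac b a)
  (@smooth_transition a b).
apply: smooth_on_eq => // y /chart_imgK[_ by_ _].
by rewrite /transition chart_mapK.
Qed.

Lemma smooth_big_tjac_swap a b :
  smooth_on (chart_img a (chart_dom b)) (fun y => big_tjac b a (chart_inv a y)).
Proof.
apply: smooth_on_block_mx; last by apply: smooth_on_tr; exact: smooth_tjac.
- exact: smooth_tjac_swap.
- exact: smooth_on_cst.
- exact: smooth_on_cst.
Qed.

Lemma smooth_endo_swap (J : endo_field M) a b : smooth_endo J ->
  smooth_on (chart_img a (chart_dom b)) (fun y => J b (chart_inv a y)).
Proof.
move=> sJ; have oV := @open_chart_dom_img a b.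
have oW : open (chart_img b setT) by apply: open_chart_img; exact: openT.
have := smooth_on_comp oV oW _ (sJ b) (@smooth_transition a b).
move=> /(_ _) H; apply: (smooth_on_eq oV _ (H _)).
  by move=> y /chart_imgK[_ by_ _]; rewrite /transition chart_mapK.
by move=> y /transition_img[x [bx _] <-]; exists x.
Qed.

End Charts.

(** * Global sections of L with prescribed value at a point *)

Section BumpSection.
Variables (R : realType) (n : nat) (M : manifold R n) (J : endo_field M).
Hypothesis gJ : gen_almost_complex J.
Variables (b : atlas M) (phi : 'cV[R]_n -> R) (c : 'cV[R[i]]_(n + n)).

(** The local section [(1 - i J)(phi c)] of L in the chart [b], extended by zero to all of [M]. *)
Definition bump_comp (a : atlas M) (x : M) : 'cV[R[i]]_(n + n) :=
  if `[< chart_dom b x >] then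
    complexify (big_tjac b a x) *m
      (proj_i (J b x) *m ((phi (chart_map b x))%:C *: c))
  else 0.

Lemma bump_law a a' x : chart_dom a x -> chart_dom a' x ->
  bump_comp a' x = complexify (big_tjac a a' x) *m bump_comp a x.
Proof.
move=> ax a'x; rewrite /bump_comp; case: asboolP => [bx|_]; last by rewrite mulmx0.
move: (proj_i _ *m _) => v; rewrite -(big_tjac_comp bx ax a'x).
exact: etrans (congr1 (mulmx^~ v) (complexifyM _ _)) (esym (mulmxA _ _ _)).
Qed.

Definition bump_section := CSection bump_law.

Lemma bump_section_eigen a x : chart_dom a x ->
  i_eigenspace (J a x) (bump_section a x).
Proof.
move=> ax; rewrite /i_eigenspace /= /bump_comp.
case: asboolP => [bx|_]; last by rewrite mulmx0 scaler0.
have gJb : linear_gcs (J b x) by case: gJ => _; exact.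
have := proj_i_eigen ((phi (chart_map b x))%:C *: c) gJb; rewrite /i_eigenspace /=.
move: (_ *m (_ *: c)) => v Jv.
by rewrite mulmxA -complexifyM (endo_law J bx ax) complexifyM -mulmxA Jv scalemxAr.
Qed.

Variable K : set 'cV[R]_n.
Hypotheses (cK : compact K) (Kb : K `<=` chart_img b setT).
Hypothesis sphi : forall r U, open U -> C_on r U phi.
Hypothesis phiK : forall y, phi y != 0 -> K y.

(** A compact set in a Hausdorff space is closed. This is what makes the extension by zero smooth at
    boundary points of the chart domain. *)
Let closed_K : closed (chart_inv b @` K).
Proof.
apply: compact_closed; first exact: space_hausdorff.
apply: continuous_compact => //.
apply: continuous_in_subspaceT => y; rewrite inE => /Kb[x [bx _] <-].
by apply: chart_inv_cont; exists x.
Qed.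

(** On the domain of [b] the section is a product of smooth factors. Any other point has the open
    complement of the image of [K] as a neighbourhood, where the section is zero. *)
Lemma bump_section_smooth : smooth_section bump_section.
Proof.
move=> a; apply: smoothC_on_local => y /chart_imgK[ay _ yE].
have [bx|nbx] := pselect (chart_dom b (chart_inv a y)).
- exists (chart_img a (chart_dom b)); first by rewrite -yE; exact: chart_img_map.
  have oV := @open_chart_dom_img _ _ _ a b.
  have oW := @open_chart_dom_img _ _ _ b a.
  have sJ := smooth_endo_swap a b gJ.1.
  have sp r : C_on r (chart_img a (chart_dom b)) (fun y => phi (transition a b y)).
    apply: (C_on_comp oW oV (@transition_img _ _ _ a b)); first exact: sphi.
    by move=> k; exact: smooth_transition.
  have := smoothC_onM oV (smoothC_complexify oV (@smooth_big_tjac_swap _ _ _ a b))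
    (smoothC_onM oV (smoothC_on_proj_i oV sJ) (smoothC_onZ_real oV c sp)).
  apply: smoothC_on_eq => // z /chart_imgK[_ bz _].
  by rewrite /= /bump_comp; case: asboolP.
- exists (chart_img a (~` (chart_inv b @` K))).
    rewrite -yE; apply: chart_img_map => // -[m /Kb[x [bx _] <-]].
    by rewrite chart_mapK// => xE; apply: nbx; rewrite -xE.
  have oV : open (chart_img a (~` (chart_inv b @` K))).
    by apply: open_chart_img; exact: closed_openC.
  have s0 : smoothC_on (chart_img a (~` (chart_inv b @` K)))
      (fun=> complexify (0 : 'cV[R]_(n + n))).
    by apply: smoothC_complexify => //; exact: smooth_on_cst.
  apply: (smoothC_on_eq oV _ s0) => z /chart_imgK[_ nK _].
  rewrite /= /bump_comp; case: asboolP => [bz|_]; last exact: map_mx0.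
  have -> : phi (chart_map b (chart_inv a z)) = 0.
    apply: contrapT => /eqP /phiK Kz; apply: nK.
    by exists (chart_map b (chart_inv a z)) => //; exact: chart_mapK.
  by rewrite scale0r !mulmx0; exact: map_mx0.
Qed.

End BumpSection.

(** * Integrability as a pointwise identity *)

Section IntegrableTensor.
Variables (R : realType) (n : nat) (M : manifold R n) (J : endo_field M).
Hypothesis gJ : gen_almost_complex J.

Lemma smoothC_proj_i_chart (b : atlas M) :
  smoothC_on (chart_img b setT) (fun m => proj_i (J b (chart_inv b m))).
Proof.
have oW : open (chart_img b setT) by apply: open_chart_img; exact: openT.
exact: smoothC_on_proj_i (gJ.1 b).
Qed.

(** The bump sections with coefficients [u] and [v] take the values [P u] and [P v] at [x], and by
    integrability their bracket there is orthogonal to [w]. Tensoriality removes the derivatives of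
    the bump function, leaving only those of [1 - i J]. *)
Lemma integrable_tensor (b : atlas M) (x : M) (u v w : 'cV[R[i]]_(n + n)) :
  courant_integrable J -> chart_dom b x -> i_eigenspace (J b x) w ->
  let E m := proj_i (J b (chart_inv b m)) in
  let D := dirC E (chart_map b x) in let P := proj_i (J b x) in
  bracket_form (fun V => D V *m u) (fun V => D V *m v)
    (usubmx (P *m u)) (usubmx (P *m v)) (usubmx w) (P *m u) (P *m v) w = 0.
Proof.
move=> iJ bx Jw E D P.
have oW : open (chart_img b setT) by apply: open_chart_img; exact: openT.
have Wm : chart_img b setT (chart_map b x) by exact: chart_img_map.
have [phi [K [cK Kb sphi phi1 phiK]]] := bump_exists oW Wm.
have sec c : section_of_L J (bump_section J b phi c).
  split; first exact: bump_section_smooth cK Kb sphi phiK.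
  exact: bump_section_eigen.
have gJb : linear_gcs (J b x) by case: gJ => _; exact.
have dE : mx_cdiff E (chart_map b x).
  exact: smoothC_cdiff oW Wm (smoothC_proj_i_chart b).
have dphi (c : 'cV[R[i]]_(n + n)) : mx_cdiff (fun m => (phi m)%:C *: c) (chart_map b x).
  by apply: (smoothC_cdiff oW Wm); apply: smoothC_onZ_real => // r; exact: sphi.
pose m0 := chart_map b x.
pose sg c m := bump_section J b phi c b (chart_inv b m).
have sgE c : \forall m \near m0, sg c m = E m *m ((phi m)%:C *: c).
  apply: filterS (open_nbhs_nbhs (conj oW Wm)) => m /chart_imgK[bm _ mE].
  rewrite /sg /= /bump_comp; case: asboolP => // _.
  by rewrite big_tjac_id// complexify1 mul1mx mE.
have dsg c : mx_cdiff (sg c) m0.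
  exact: smoothC_cdiff oW Wm ((sec c).1 b).
have EP : E m0 = P by rewrite /E chart_mapK.
have phi_m0 (c : 'cV[R[i]]_(n + n)) : (phi m0)%:C *: c = c by rewrite phi1 scale1r.
have sg0 c : sg c m0 = P *m c.
  by rewrite (nbhs_singleton (sgE c)) EP phi_m0.
have Dsg c : dirC (sg c) m0 = dirC (fun m => E m *m ((phi m)%:C *: c)) m0.
  by apply/funext => V; exact: dirC_eq (sgE c).
have H : pairing (courant_bracket (sg u) (sg v) m0) w = 0.
  exact: eigen_isotropic gJb (iJ _ _ (sec u) (sec v) b x bx) Jw.
have PP c d : pairing (E m0 *m c) (E m0 *m d) = 0.
  by rewrite EP; exact: (eigen_isotropic gJb (proj_i_eigen c gJb) (proj_i_eigen d gJb)).
have Pw c : pairing (E m0 *m c) w = 0.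
  by rewrite EP; exact: (eigen_isotropic gJb (proj_i_eigen c gJb) Jw).
have did k : differentiable (fun z : 'cV[R]_n => z k 0) m0.
  exact: differentiable_coord.
(* Tensoriality is applied on [M] itself, with the identity in the role of the inclusion. *)
have := @bracket_form_tensor R n n E (fun m => m) (fun m => (phi m)%:C *: u)
  (fun m => (phi m)%:C *: v) m0 (usubmx (P *m u)) (usubmx (P *m v)) (usubmx w) w
  dE did (dphi u) (dphi v) PP Pw.
cbv beta zeta; rewrite jac_id complexify1 !mul1mx !phi_m0 EP => <-.
by rewrite -!Dsg -!sg0 -courant_pairing.
Qed.

End IntegrableTensor.

(** * Submanifolds *)

Section FrameSmooth.
Variables (R : realType) (q n p k : nat) (V : set 'cV[R]_q).
Variables (F : 'cV[R]_q -> 'M[R]_(n, p)) (J : 'cV[R]_q -> 'M[R]_(n + n)).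
Variable (S : 'cV[R]_q -> 'M[R]_(n, k)).
Hypotheses (oV : open V) (sF : smooth_on V F) (sJ : smooth_on V J) (sS : smooth_on V S).
Hypothesis unitM : forall y, V y -> frame_mx (F y) (J y) (S y) \in unitmx.

Lemma smooth_frame_solution : smooth_on V (fun y => frame_solution (F y) (J y) (S y)).
Proof.
have sFt := smooth_on_tr sF; have sSt := smooth_on_tr sS.
have s0 a b : smooth_on V (fun=> 0 : 'M[R]_(a, b)) by exact: smooth_on_cst.
have spi : smooth_on V (fun y => sharp_pi (J y)).
  by rewrite /sharp_pi; under eq_fun do rewrite /ursubmx usubmxEsub rsubmxEsub;
    do 2 apply: smooth_on_mxsub.
have sA : smooth_on V (fun y => ulsubmx (J y)).
  by under eq_fun do rewrite /ulsubmx usubmxEsub lsubmxEsub;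
    do 2 apply: smooth_on_mxsub.
apply: smooth_onM => //.
  apply: smooth_on_invmx => //; apply: smooth_on_block_mx => //.
  - exact: smooth_onM.
  - exact: smooth_onM.
  - by apply: smooth_onN => //; do 2 apply: smooth_onM => //.
apply: smooth_on_block_mx => //; first exact: smooth_on_cst.
by do 2 apply: smooth_onM => //.
Qed.

Lemma smooth_frame_lift : smooth_on V (fun y => frame_lift (F y) (J y) (S y)).
Proof.
apply: smooth_on_col_mx.
  by apply: smooth_on_row_mx => //; exact: smooth_on_cst.
apply: smooth_onM => //; under eq_fun do rewrite dsubmxEsub.
by apply: smooth_on_mxsub; exact: smooth_frame_solution.
Qed.

Lemma smooth_frame_induced : smooth_on V (fun y => frame_induced (F y) (J y) (S y)).
Proof.
apply: smooth_on_col_mx.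
  under eq_fun do rewrite usubmxEsub.
  by apply: smooth_on_mxsub; exact: smooth_frame_solution.
apply: smooth_onM => //; first exact: smooth_on_tr.
under eq_fun do rewrite dsubmxEsub.
by apply: smooth_on_mxsub; apply: smooth_onM => //; exact: smooth_frame_lift.
Qed.

End FrameSmooth.

(** * The induced field near a point of the submanifold *)

Section Submanifold.
Variables (R : realType) (n p : nat) (M : manifold R n) (N : manifold R p).
Variable iota : N -> M.
Hypothesis siota : smooth_map iota.
Variable J : endo_field M.
Hypothesis gJ : gen_almost_complex J.
Variable Jt : endo_field N.
Hypothesis iJt : induced_field iota J Jt.

Definition local_rep (a : atlas N) (b : atlas M) (y : 'cV[R]_p) : 'cV[R]_n :=
  chart_map b (iota (chart_inv a y)).

Let dom_rep (a : atlas N) (b : atlas M) := chart_img a (iota @^-1` chart_dom b).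

Let open_dom_rep a b : open (dom_rep a b).
Proof.
apply: open_chart_img; apply: open_comp; last exact: chart_dom_open.
by move=> x _; exact: siota.1.
Qed.

Lemma smooth_local_rep a b : smooth_on (dom_rep a b) (local_rep a b).
Proof. exact: siota.2. Qed.

Lemma local_rep_differentiable a b x i : chart_dom a x -> chart_dom b (iota x) ->
  differentiable (fun z => local_rep a b z i 0) (chart_map a x).
Proof.
move=> ax bx; have ix : dom_rep a b (chart_map a x) by exact: chart_img_map.
exact: (smooth_on_differentiable (@open_dom_rep a b) _ _ (@smooth_local_rep a b) ix).
Qed.

Lemma map_jac_chart a a' b x : chart_dom a x -> chart_dom a' x ->
  chart_dom b (iota x) ->
  map_jac iota a' b x = map_jac iota a b x *m tjac a' a x.
Proof.
move=> ax a'x bx; have tx : transition a' a (chart_map a' x) = chart_map a x.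
  by rewrite /transition chart_mapK.
rewrite /map_jac /tjac -{1}tx -(@jac_comp _ _ _ _ (local_rep a b) (transition a' a)).
- apply: jac_eq; have ix := chart_img_map a'x ax.
  apply: filterS (open_nbhs_nbhs (conj (@open_chart_dom_img _ _ _ a' a) ix)) => z.
  by move=> /chart_imgK[_ az _]; rewrite /local_rep /transition chart_mapK.
- by move=> i; rewrite tx; exact: local_rep_differentiable.
- by move=> i; exact: transition_differentiable.
Qed.

(** By the chain rule the image of the differential does not depend on the chart of [N], so the
    chart quantified in the definition can be fixed. *)
Lemma tangent_plus_sharpE a b x : chart_dom a x -> chart_dom b (iota x) ->
  tangent_plus_sharp iota J b x =
  [set w | exists (v : 'cV[R]_p) (alpha : 'cV[R]_n),
     w = map_jac iota a b x *m v + sharp_pi (J b (iota x)) *m alpha].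
Proof.
move=> ax bx; apply/seteqP; split=> w /=; last by move=> [v [alpha ->]]; exists a, v, alpha.
move=> [a' [v [alpha [a'x ->]]]]; exists (tjac a' a x *m v), alpha.
by rewrite mulmxA -map_jac_chart.
Qed.

Section LocalFrame.
Variables (a : atlas N) (b : atlas M) (U : set N) (k : nat) (S : N -> 'M[R]_(n, k)).
Hypotheses (oU : open U) (Ub : U `<=` iota @^-1` chart_dom b).
Hypothesis sS : smooth_on (chart_img a U) (fun y => S (chart_inv a y)).
Hypothesis SV : forall z, U z -> injective (fun c : 'cV[R]_k => S z *m c) /\
  tangent_plus_sharp iota J b z = range (fun c : 'cV[R]_k => S z *m c).

Let V := chart_img a U.
Let oV : open V. Proof. exact: open_chart_img. Qed.
Let F y := jac (local_rep a b) y.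
Let Jl y := J b (iota (chart_inv a y)).
Let Sl y := S (chart_inv a y).
Let Jtl y := Jt a (chart_inv a y).

Let V_rep : V `<=` dom_rep a b.
Proof. by move=> _ [x [ax Ux] <-]; apply: chart_img_map => //; exact: Ub. Qed.

Let sloc : smooth_on V (local_rep a b).
Proof. exact: smooth_onS V_rep (@smooth_local_rep a b). Qed.

Let sF : smooth_on V F.
Proof. exact: smooth_on_jac. Qed.

Let rep_img y : V y -> chart_img b setT (local_rep a b y).
Proof. by move=> /chart_imgK[_ /Ub bx _]; exact: chart_img_map. Qed.

Let sJl : smooth_on V Jl.
Proof.
have oW : open (chart_img b setT) by apply: open_chart_img; exact: openT.
apply: (smooth_on_eq oV _ (smooth_on_comp oV oW rep_img (gJ.1 b) sloc)).
by move=> y /chart_imgK[_ /Ub bx _]; rewrite /local_rep chart_mapK.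
Qed.

Let gJl y : V y -> linear_gcs (Jl y).
Proof. by move=> /chart_imgK[_ /Ub bx _]; exact: gJ.2. Qed.

Let map_jacE y : V y -> map_jac iota a b (chart_inv a y) = F y.
Proof. by move=> /chart_imgK[_ _ yE]; rewrite /map_jac yE. Qed.

Let iJl y : V y -> induced_structure (F y) (Jl y) (Jtl y).
Proof.
move=> Vy; rewrite -map_jacE//; have [ay Uy _] := chart_imgK Vy.
exact: iJt ay (Ub Uy).
Qed.

Let Sinj y : V y -> injective (fun c : 'cV[R]_k => Sl y *m c).
Proof. by move=> /chart_imgK[_ Uy _]; exact: (SV Uy).1. Qed.

Let Srange y : V y -> [set w | exists (v : 'cV[R]_p) (alpha : 'cV[R]_n),
  w = F y *m v + sharp_pi (Jl y) *m alpha] = range (fun c : 'cV[R]_k => Sl y *m c).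
Proof.
move=> Vy; have [ay Uy _] := chart_imgK Vy.
by rewrite -(SV Uy).2 (tangent_plus_sharpE ay (Ub Uy)) map_jacE.
Qed.

Let unitM y : V y -> frame_mx (F y) (Jl y) (Sl y) \in unitmx.
Proof. move=> Vy; exact: (frame_mx_unit (gJl Vy) (iJl Vy) (Sinj Vy) (Srange Vy)). Qed.

Lemma local_smooth_induced : smooth_on V Jtl.
Proof.
apply: (smooth_on_eq oV _ (smooth_frame_induced oV sF sJl sS unitM)) => y Vy.
exact/esym/(frame_inducedE (gJl Vy) (iJl Vy) (Sinj Vy) (Srange Vy)).
Qed.

Let E m := proj_i (J b (chart_inv b m)).

Let lift_coef (s : csection N) y : 'cV[R[i]]_(n + n) :=
  2^-1 *: (complexify (frame_lift (F y) (Jl y) (Sl y)) *m s a (chart_inv a y)).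

(** The lift is kept in the form [E] times a coefficient, the shape on which [bracket_form_tensor]
    acts. *)
Let lift (s : csection N) y := E (local_rep a b y) *m lift_coef s y.

Let E_rep y : V y -> E (local_rep a b y) = proj_i (Jl y).
Proof. by move=> /chart_imgK[_ /Ub bx _]; rewrite /E /local_rep chart_mapK. Qed.

Let liftP s y : section_of_L Jt s -> V y ->
  [/\ i_eigenspace (Jl y) (lift s y),
      usubmx (lift s y) = complexify (F y) *m usubmx (s a (chart_inv a y)) &
      dsubmx (s a (chart_inv a y)) = (complexify (F y))^T *m dsubmx (lift s y)].
Proof.
move=> [_ es] Vy; have [ay Uy _] := chart_imgK Vy.
have := eigen_lift (gJl Vy) (iJl Vy) (Sinj Vy) (Srange Vy) (es _ _ ay).
by cbv zeta; rewrite /lift E_rep// => -[h1 h2 h3].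
Qed.

Lemma local_integrable x s t : courant_integrable J -> chart_dom a x -> U x ->
  section_of_L Jt s -> section_of_L Jt t ->
  i_eigenspace (Jt a x) (courant s t a x).
Proof.
move=> iJ ax Ux Ls Lt; pose y := chart_map a x.
have Vy : V y by exact: chart_img_map.
have bx := Ub Ux.
have JlE : Jl y = J b (iota x) by rewrite /Jl chart_mapK.
have JtlE : Jtl y = Jt a x by rewrite /Jtl chart_mapK.
have gJt : linear_gcs (Jt a x) by have [] := iJt ax bx.
pose sl (s : csection N) z := s a (chart_inv a z).
have oaT : open (chart_img a setT) by apply: open_chart_img; exact: openT.
have aTy : chart_img a setT y by exact: chart_img_map.
have dsl s' : section_of_L Jt s' -> mx_cdiff (sl s') y.
  by move=> [ss _]; exact: smoothC_cdiff oaT aTy (ss a).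
have drep i : differentiable (fun z => local_rep a b z i 0) y.
  exact: local_rep_differentiable.
have dE : mx_cdiff E (local_rep a b y).
  have oW : open (chart_img b setT) by apply: open_chart_img; exact: openT.
  exact: smoothC_cdiff oW (rep_img Vy) (smoothC_proj_i_chart gJ b).
have dcoef s' : section_of_L Jt s' -> mx_cdiff (lift_coef s') y.
  (* As a product of matrices, with the factor [2^-1] as a scalar matrix, the coefficient is
     differentiable by [mx_cdiffM]. *)
  move=> Ls'; have -> : lift_coef s' =
      (fun z => ((2^-1)%:M *m complexify (frame_lift (F z) (Jl z) (Sl z))) *m sl s' z).
    by apply/funext => z; rewrite /lift_coef mul_scalar_mx -scalemxAl.
  apply: mx_cdiffM; last exact: dsl.
  apply: mx_cdiffM; first exact: mx_cdiff_cst.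
  apply: (smoothC_cdiff oV Vy); apply: smoothC_complexify => //.
  exact: smooth_frame_lift.
have dlift s' : section_of_L Jt s' -> mx_cdiff (lift s') y.
  by move=> Ls'; apply: mx_cdiffM; [exact: mx_cdiff_comp|exact: dcoef].
have lifts_sl s' : section_of_L Jt s' -> lifts (local_rep a b) y (sl s') (lift s').
  move=> Ls'; apply: filterS (open_nbhs_nbhs (conj oV Vy)) => z Vz.
  by have [_ h1 h2] := liftP Ls' Vz; split.
(* Membership of the bracket in the eigenspace is tested by pairing with each [r] of it. Such an [r]
   is the pullback of some [r'] in L at the single point considered. *)
apply: eigen_maximal gJt _ => r Jr.
have [_ LE] := iJt ax bx; rewrite LE in Jr.
have [Z [eta [rE Jr']]] := Jr.
have FE : map_jac iota a b x = F y by rewrite -(map_jacE Vy) chart_mapK.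
rewrite FE in rE Jr'; set r' := col_mx _ eta in Jr'.
have ur : usubmx r' = complexify (F y) *m usubmx r by rewrite rE !col_mxKu.
have dr : dsubmx r = (complexify (F y))^T *m dsubmx r' by rewrite rE !col_mxKd.
apply: etrans (courant_pairing r (dsl s Ls) (dsl t Lt)) _.
(* From sections over [N] to their lifts along [N]. *)
apply: etrans (bracket_form_pullback oV Vy sloc (dsl s Ls) (dlift s Ls) (lifts_sl s Ls)
  (dsl t Lt) (dlift t Lt) (lifts_sl t Lt) ur dr) _.
have gJb := gJl Vy.
have EE c d : pairing (E (local_rep a b y) *m c) (E (local_rep a b y) *m d) = 0.
  by rewrite E_rep//; exact: (eigen_isotropic gJb (proj_i_eigen c gJb) (proj_i_eigen d gJb)).
have Jr'' : i_eigenspace (Jl y) r' by rewrite JlE.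
have Er c : pairing (E (local_rep a b y) *m c) r' = 0.
  by rewrite E_rep//; exact: (eigen_isotropic gJb (proj_i_eigen c gJb) Jr'').
(* From the lifts along [N] to an expression at one point of [M], in which only [E] is
   differentiated and all directions are images under the differential of the inclusion; there
   [integrable_tensor] applies. *)
apply: etrans (bracket_form_tensor _ _ _ dE drep (dcoef s Ls) (dcoef t Lt) EE Er) _.
have [_ us _] := liftP Ls Vy; have [_ ut _] := liftP Lt Vy.
have := integrable_tensor gJ (lift_coef s y) (lift_coef t y) iJ bx Jr'.
cbv zeta.
have -> : chart_map b (iota x) = local_rep a b y by rewrite /local_rep chart_mapK.
rewrite -JlE -(E_rep Vy) -/(lift s y) -/(lift t y) us ut ur.
exact.
Qed.

End LocalFrame.

End Submanifold.

Theorem proposition3p1 (R : realType) (n p : nat)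
  (M : manifold R n) (N : manifold R p) (iota : N -> M)
  (Hiota : injective_immersion iota)
  (J : endo_field M) (HJ : gen_almost_complex J)
  (Jt : endo_field N) (HJt : induced_field iota J Jt)
  (Hsub : smooth_subbundle_along iota (tangent_plus_sharp iota J)) :
  smooth_endo Jt /\ (courant_integrable J -> courant_integrable Jt).
Proof.
(* Both claims are local on [N], and near each point the subbundle hypothesis supplies a frame. *)
have [_ siota _] := Hiota; split.
  move=> a; apply: smooth_on_local => y /chart_imgK[ay _ yE].
  have [b bx] := chart_cover (iota (chart_inv a y)).
  have [U [k [S [oU Uy Ub sS SV]]]] := Hsub b _ bx.
  exists (chart_img a U); first by rewrite -yE; exact: chart_img_map.
  exact: (local_smooth_induced siota HJ HJt oU Ub (sS a) SV).
move=> iJ s t Ls Lt a x ax.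
have [b bx] := chart_cover (iota x).
have [U [k [S [oU Ux Ub sS SV]]]] := Hsub b _ bx.
exact: (local_integrable siota HJ HJt oU Ub (sS a) SV).
Qed.
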